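(* Let $n\ge 2$ and let $\lambda$ be a partition of $n$ with Durfee length $d=dl(\lambda)$ and with $r_1$ removable boxes. Let $|\lambda\cap\lambda^t|$ be the number of boxes in the intersection of the Young diagrams of $\lambda$ and its conjugate $\lambda^t$. (1) If $|\lambda\cap\lambda^t|<n-1$, then $sg(\lambda,(2,1^{n-2}))=0=ag(\lambda,(2,1^{n-2}))$. (2) If $|\lambda\cap\lambda^t|=n-1$, then $sg(\lambda,(2,1^{n-2}))=1$ and $ag(\lambda,(2,1^{n-2}))=0$ if $\frac{n-1-d}{2}$ is even, while $sg(\lambda,(2,1^{n-2}))=0$ and $ag(\lambda,(2,1^{n-2}))=1$ if $\frac{n-1-d}{2}$ is odd. (3) If $|\lambda\cap\lambda^t|=n$, i.e. $\lambda=\lambda^t$, set $\varepsilon_\lambda=(-1)^{(n-d)/2}$. If $r_1$ is odd, then $sg(\lambda,(2,1^{n-2}))=\frac{r_1-1}{2}=ag(\lambda,(2,1^{n-2}))$. If $r_1$ is even, then $$sg(\lambda,(2,1^{n-2}))=\left\lfloor\frac{r_1-\varepsilon_\lambda}{2}\right\rfloor,\qquad ag(\lambda,(2,1^{n-2}))=\left\lfloor\frac{r_1+\varepsilon_\lambda}{2}\right\rfloor.$$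
   Context: For a partition $\lambda$ of $n$, $[\lambda]$ denotes the irreducible complex character of the symmetric group $S_n$ labelled by $\lambda$. For a character $\chi$ of a finite group, $S^2(\chi)(g)=\tfrac12(\chi(g)^2+\chi(g^2))$ and $A^2(\chi)(g)=\tfrac12(\chi(g)^2-\chi(g^2))$. The coefficients $sg$ and $ag$ are defined by $S^2([\lambda])=\sum_\mu sg(\lambda,\mu)[\mu]$ and $A^2([\lambda])=\sum_\mu ag(\lambda,\mu)[\mu]$. The Durfee (diagonal) length $dl(\lambda)$ is the number of boxes on the main diagonal of the Young diagram of $\lambda$. A box of $\lambda$ is removable if deleting it leaves the Young diagram of a partition. *)

(* Defs.v *)
From HB Require Import structures.
From mathcomp Require Import all_boot all_order all_algebra.
From mathcomp Require Import all_fingroup all_solvable all_field all_character.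

Set Implicit Arguments.
Unset Strict Implicit.
Unset Printing Implicit Defensive.

Import GroupScope Order.TTheory GRing.Theory Num.Theory.
Local Open Scope ring_scope.

(* Partitions and Young diagrams *)

Definition is_partition (n : nat) (la : seq nat) : bool :=
  [&& sorted geq la, 0%N \notin la & sumn la == n].

(* Boxes are (row, column), both numbered from 0. For a partition of n no box
   is lost by bounding the coordinates by n. *)
Definition diagram (n : nat) (la : seq nat) : {set 'I_n * 'I_n} :=
  [set b : 'I_n * 'I_n | (b.2 < nth 0 la b.1)%N].

Definition conj_part (la : seq nat) : seq nat :=
  mkseq (fun j => count (fun p => (j < p)%N) la) (head 0%N la).

Definition durfee (n : nat) (la : seq nat) : nat :=
  #|[set i : 'I_n | (i, i) \in diagram n la]|.

(* The partition is padded with zeros to n parts. *)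
Definition is_diagram (n : nat) (D : {set 'I_n * 'I_n}) : bool :=
  [exists mu : n.-tuple 'I_n.+1,
     let m := [seq val p | p <- mu] in sorted geq m && (D == diagram n m)].

Definition removable (n : nat) (la : seq nat) : {set 'I_n * 'I_n} :=
  [set b in diagram n la | is_diagram (diagram n la :\ b)].

(* Irreducible characters of S_n *)

Section Stabilisers.
Variables (n : nat) (f : nat -> nat).

Definition fibre_stab : {set 'S_n} :=
  [set s : 'S_n | [forall k : 'I_n, f (s k) == f k]].

Lemma fibre_stab_group_set : group_set fibre_stab.
Proof.
apply/group_setP; split=> [|s t]; rewrite ?inE.
  by apply/forallP=> k; rewrite perm1.
move=> /forallP Hs /forallP Ht; apply/forallP=> k.
by rewrite permM (eqP (Ht _)) (eqP (Hs _)).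
Qed.

Canonical fibre_stab_group := Group fibre_stab_group_set.
End Stabilisers.

(* The boxes of la are numbered 0, ..., n-1 row by row: number k lies in row
   [reshape_index la k] and column [reshape_offset la k]. *)
Definition row_stab (n : nat) (la : seq nat) : {group 'S_n} :=
  fibre_stab_group n (reshape_index la).

Definition col_stab (n : nat) (la : seq nat) : {group 'S_n} :=
  fibre_stab_group n (reshape_offset la).

Lemma sign_cfun_subproof (n : nat) (H : {group 'S_n}) :
  is_class_fun <<H>> [ffun s : 'S_n => (-1) ^+ s *+ (s \in H) : algC].
Proof.
rewrite genGid; apply: intro_class_fun => [s t Hs Ht | s /negPf-> //].
by rewrite groupJ // odd_permJ Hs.
Qed.
Definition sign_cfun (n : nat) (H : {group 'S_n}) : 'CF(H) :=
  Cfun 0 (sign_cfun_subproof H).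

(* The label la belongs to the unique common irreducible constituent of the
   characters induced from the trivial character of the row stabiliser and from
   the sign character of the column stabiliser of a tableau of shape la; the
   default value 0 is irrelevant when la is a partition of n. *)
Definition part_Iirr (n : nat) (la : seq nat) : Iirr [set: 'S_n] :=
  odflt 0 [pick i |
    (i \in irr_constt ('Ind[[set: 'S_n]] (1 : 'CF(row_stab n la)))) &&
    (i \in irr_constt ('Ind[[set: 'S_n]] (sign_cfun (col_stab n la))))].

Definition part_char (n : nat) (la : seq nat) : 'CF([set: 'S_n]) :=
  'chi_(part_Iirr n la).

(* Symmetric and alternating squares *)

Section Squares.
Variables (gT : finGroupType) (G : {group gT}) (chi : 'CF(G)).

Lemma square_cfun_subproof (e : algC) :
  is_class_fun <<G>>
    [ffun g => (chi g ^+ 2 + e * chi (g ^+ 2)%g) / 2 *+ (g \in G)].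
Proof.
rewrite genGid; apply: intro_class_fun => [x y Gx Gy | x /negPf-> //].
by rewrite groupJ // -conjXg !cfunJ ?Gx.
Qed.

Definition sym_square : 'CF(G) := Cfun 0 (square_cfun_subproof 1).
Definition alt_square : 'CF(G) := Cfun 0 (square_cfun_subproof (-1)).

Lemma sym_squareE g : g \in G ->
  sym_square g = (chi g ^+ 2 + chi (g ^+ 2)%g) / 2.
Proof. by move=> Gg; rewrite cfunE Gg mul1r. Qed.

Lemma alt_squareE g : g \in G ->
  alt_square g = (chi g ^+ 2 - chi (g ^+ 2)%g) / 2.
Proof. by move=> Gg; rewrite cfunE Gg mulN1r. Qed.
End Squares.

(* The coefficient of [mu] in the expansion over the basis of irreducible
   characters. *)
Definition sg (n : nat) (la mu : seq nat) : algC :=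
  coord (irr [set: 'S_n]) (part_Iirr n mu) (sym_square (part_char n la)).

Definition ag (n : nat) (la mu : seq nat) : algC :=
  coord (irr [set: 'S_n]) (part_Iirr n mu) (alt_square (part_char n la)).

(* Main.v *)
Require Import Defs.
From HB Require Import structures.
From mathcomp Require Import all_boot all_order all_algebra.
From mathcomp Require Import all_fingroup all_solvable all_field all_character.
From mathcomp Require Import ring lra zify.

Set Implicit Arguments.
Unset Strict Implicit.
Unset Printing Implicit Defensive.

Import Order.TTheory GRing.Theory Num.Theory.
Local Open Scope ring_scope.

(** Write chi for the character of la, sigma for the sign, and pi for the number
    of fixed points, which is the character induced from the trivial character
    of a point stabiliser. The label (2, 1^(n-2)) belongs to psi = sigma (pi - 1).
    With S = '[chi^2, psi] and T the mean of chi(g^2) psi(g), the coefficients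
    are sg = (S + T) / 2 and ag = (S - T) / 2, so both numbers have to be found.

    Averaging a class function against pi is averaging its restriction over a
    point stabiliser. Hence S is the inner product of the restrictions of
    chi sigma and chi to S_(n-1), minus '[chi sigma, chi]. As chi sigma belongs
    to the conjugate diagram, the branching rule turns S into the number of
    diagrams with n - 1 boxes inside la and its conjugate, minus 1 if la is
    self-conjugate [square_coord]. In the same way T is the sum of the
    sign-twisted Frobenius-Schur indicators of the diagrams with n - 1 boxes
    inside la, minus the indicator of la [square_twist]. That indicator is 0 for
    a diagram that is not symmetric and (-1)^((n-d)/2) for a symmetric one
    [sign_indicator_shape]. The rest is counting: a diagram of n - 1 boxes
    inside la and its conjugate is the core (la meet its conjugate) if the core
    has n - 1 boxes, and is la minus a corner if la is self-conjugate; in that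
    last case the transposition acts on the corners with at most one fixed
    point, so that a diagonal corner exists exactly if r1 is odd.

    Three facts about symmetric groups carry this. All groups are the subgroups
    Sym(A) of one symmetric group, and a filling t of a diagram by A plays the
    role of a tableau, with row group R and column group C.

    - Labels. Summing over irreducible characters, row multiplicity in t times
      column multiplicity in u gives, up to the orders of the row and the column
      group, the number of y for which no two points share a row of t y and a
      column of u [sum_row_col_mult]. For t = u these y form C R, which gives
      exactly one irreducible character per diagram, with both multiplicities 1;
      for different diagrams the dominance order separates the
      labels [labelled_inj].

    - Branching. On the representation of a diagram D the product of the row sum
      and the signed column sum is nonzero, and it factors through the same
      product for D minus a corner, so each of these occurs in the restriction
      [branching_neq0]. Conversely the norm of the character induced from E is
      1 plus the norm of a restriction, which by induction is 1 plus the number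
      of corners of E, and a diagram has more addable boxes than corners: there
      is room for nothing else, and every multiplicity is 1 [branching].

    - The indicator. If chi is real with chi sigma = chi, and M is an element of
      the group algebra that acts with rank one and that the anti-automorphism
      g |-> sigma(g) g^-1 multiplies by delta = 1 or -1, then the indicator of
      chi is delta [twisted_indicator1]. For a symmetric diagram M is the Young
      symmetriser times the transposition s of the tableau, delta is the sign of
      s, and s has (n - d) / 2 cycles of length 2. *)

(** * Sums over a group in a representation *)

(** In a rank factorisation P = C B the product B C is the identity matrix. *)
Lemma mxtrace_idempotent (F : fieldType) (n : nat) (P : 'M[F]_n) :
  P *m P = P -> \tr P = (\rank P)%:R.
Proof.
move=> PP; rewrite -{1}(mulmx_base P) mxtrace_mulC.
suff ->: row_base P *m col_base P = 1%:M by rewrite mxtrace1.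
apply: (row_free_inj (row_base_free P)); apply: (row_full_inj (col_base_full P)).
by rewrite mul1mx -[_ *m row_base P]mulmxA mulmxA !mulmx_base.
Qed.

Section WeightedSums.

Variables (gT : finGroupType) (G : {group gT}).

(** For a linear character s this is #|K| times the projection on the vectors on
    which K acts by the conjugate of s. *)
Definition weighted_sum (K : {group gT}) (s : 'CF(K)) (n : nat)
    (rG : mx_representation algC G n) : 'M_n := \sum_(g in K) s g *: rG g.

Variables (K : {group gT}) (s : 'CF(K)) (n : nat).
Variable rG : mx_representation algC G n.
Hypotheses (sKG : K \subset G) (lin_s : s \is a linear_char).

Lemma mxtrace_weighted_sum : \tr (weighted_sum s rG) = \sum_(g in K) s g * cfRepr rG g.
Proof.
rewrite /weighted_sum raddf_sum; apply: eq_bigr => g Kg /=.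
by rewrite mxtraceZ cfunE (subsetP sKG) // mulr1n.
Qed.

Lemma weighted_sum_act g : g \in K ->
  rG g *m weighted_sum s rG = s g^-1%g *: weighted_sum s rG /\
  weighted_sum s rG *m rG g = s g^-1%g *: weighted_sum s rG.
Proof.
move=> Kg; have KG := subsetP sKG; split.
  rewrite /weighted_sum mulmx_sumr scaler_sumr.
  rewrite [RHS](reindex_inj (mulgI g)) /=.
  rewrite [RHS](eq_bigl (mem K)) => [|h]; last by rewrite /= groupMl.
  apply: eq_bigr => h Kh; rewrite -scalemxAr -repr_mxM ?KG // scalerA.
  by rewrite -(lin_charM lin_s) ?groupV ?groupM // mulKg.
rewrite /weighted_sum mulmx_suml scaler_sumr.
rewrite [RHS](reindex_inj (mulIg g)) /=.
rewrite [RHS](eq_bigl (mem K)) => [|h]; last by rewrite /= groupMr.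
apply: eq_bigr => h Kh; rewrite -scalemxAl -repr_mxM ?KG // scalerA mulrC.
by rewrite -(lin_charM lin_s) ?groupV ?groupM // mulgK.
Qed.

Lemma weighted_sum_mul (L : {group gT}) (t : 'CF(L)) : L \subset K -> {in L, t =1 s} ->
  weighted_sum t rG *m weighted_sum s rG = #|L|%:R *: weighted_sum s rG /\
  weighted_sum s rG *m weighted_sum t rG = #|L|%:R *: weighted_sum s rG.
Proof.
move=> sLK ts; have E g : g \in L -> t g * s g^-1%g = 1.
  move=> Lg; have Kg := subsetP sLK g Lg.
  by rewrite ts // -(lin_charM lin_s) ?groupV // mulgV lin_char1.
split.
  rewrite {1}/weighted_sum mulmx_suml (eq_bigr (fun=> weighted_sum s rG)) => [|g Lg].
    by rewrite sumr_const scaler_nat.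
  have [e _] := weighted_sum_act (subsetP sLK g Lg).
  by rewrite -scalemxAl e scalerA E // scale1r.
rewrite {2}/weighted_sum mulmx_sumr (eq_bigr (fun=> weighted_sum s rG)) => [|g Lg].
  by rewrite sumr_const scaler_nat.
have [_ e] := weighted_sum_act (subsetP sLK g Lg).
by rewrite -scalemxAr e scalerA E // scale1r.
Qed.

(** The sum divided by #|K| is idempotent, so its trace is its rank. *)
Lemma mxrank_weighted_sum : \tr (weighted_sum s rG) = #|K|%:R * (\rank (weighted_sum s rG))%:R.
Proof.
have K0 : #|K|%:R != 0 :> algC by rewrite neq0CG.
set E := weighted_sum s rG; pose P := #|K|%:R^-1 *: E.
have EP : E = #|K|%:R *: P by rewrite scalerA mulfV // scale1r.
have EE : E *m E = #|K|%:R *: E by have [] := weighted_sum_mul (subxx K) (fun g _ => erefl (s g)).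
have PP : P *m P = P.
  by rewrite -scalemxAl -scalemxAr EE !scalerA mulfVK.
by rewrite {1}EP mxtraceZ (mxtrace_idempotent PP) mxrank_scale_nz // invr_eq0.
Qed.

(** The passage between operators and characters: the trace is a nonzero multiple of
    the rank. *)
Lemma weighted_sum_eq0 : (weighted_sum s rG == 0) = (\sum_(g in K) s g * cfRepr rG g == 0).
Proof.
rewrite -mxtrace_weighted_sum mxrank_weighted_sum mulf_eq0 (negPf (neq0CG K)).
by rewrite pnatr_eq0 mxrank_eq0.
Qed.

End WeightedSums.

Section Averages.

Variables (gT : finGroupType) (G : {group gT}) (n : nat).
Variable rG : mx_representation algC G n.
Hypothesis irrG : mx_irreducible rG.

Let n0 : n%:R != 0 :> algC.
Proof. by case/mx_abs_irrP: (groupC irrG) => n_gt0 _; rewrite pnatr_eq0 -lt0n. Qed.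

Lemma irr_centraliser_scalar (A : 'M_n) :
  (forall g, g \in G -> rG g *m A = A *m rG g) -> A = (\tr A / n%:R)%:M.
Proof.
move=> cA; have /is_scalar_mxP[a ->]: is_scalar_mx A.
  apply: mx_abs_irr_cent_scalar (groupC irrG) _ _.
  by apply/centgmxP=> g Gg; rewrite cA.
by rewrite mxtrace_scalar -[a *+ n]mulr_natr mulfK.
Qed.

(** The average commutes with the representation, so by Schur's lemma it is a
    scalar, which the trace determines. *)
Lemma schur_average (X : 'M_n) :
  \sum_(g in G) rG g *m X *m rG g^-1%g = (#|G|%:R * \tr X / n%:R)%:M.
Proof.
set S := \sum_(g in G) _.
rewrite [S]irr_centraliser_scalar => [|h Gh]; last first.
  rewrite mulmx_sumr mulmx_suml.
  rewrite [RHS](reindex_inj (mulgI h)) /=.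
  rewrite [RHS](eq_bigl (mem G)) => [|g]; last by rewrite /= groupMl.
  apply: eq_bigr => g Gg; rewrite invMg !repr_mxM ?groupV // !mulmxA.
  by rewrite repr_mxKV.
rewrite raddf_sum (eq_bigr (fun=> \tr X)) => [|g Gg] /=.
  by rewrite sumr_const -[\tr X *+ _]mulr_natl.
by rewrite mxtrace_mulC mulmxA -repr_mxM ?groupV // mulVg repr_mx1 mul1mx.
Qed.

(** Averaging A (g B g^-1) over g gives a nonzero multiple of A. *)
Lemma exists_link (A B : 'M_n) :
  A != 0 -> \tr B != 0 -> exists2 g, g \in G & A *m rG g *m B != 0.
Proof.
move=> A0 B0; apply/exists_inP; apply: contraR A0 => /exists_inPn H.
have /eqP := congr1 (mulmx A) (schur_average B).
rewrite mulmx_sumr big1 => [|g Gg]; last first.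
  by rewrite !mulmxA (eqP (negPn (H g Gg))) mul0mx.
rewrite eq_sym mul_mx_scalar scaler_eq0 !mulf_eq0 invr_eq0.
by rewrite (negPf (neq0CG G)) (negPf B0) (negPf n0).
Qed.

End Averages.

Section Constituents.

Variables (gT : finGroupType) (G : {group gT}).

(** The image in rG of the group ring element with coefficients x. *)
Definition ring_image (x : gT -> algC) (n : nat) (rG : mx_representation algC G n) :=
  \sum_(g in G) x g *: rG g.

Lemma ring_image_dadd x (rG1 rG2 : representation algC G) :
  ring_image x (dadd_grepr rG1 rG2) = block_mx (ring_image x rG1) 0 0 (ring_image x rG2).
Proof.
rewrite /ring_image /=; elim/big_rec3: _ => [|g A B C _ ->].
  by rewrite -[LHS]/(0 : 'M_(_ + _)) -[in LHS]block_mx0.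
by rewrite scale_block_mx !scaler0 add_block_mx !addr0.
Qed.

(** The representation is similar to the direct sum of its constituents, and the
    image in a direct sum is block diagonal. *)
Lemma ring_image_constituent x n (rG : mx_representation algC G n) :
  ring_image x rG != 0 ->
  exists2 i, i \in irr_constt (cfRepr rG) & ring_image x 'Chi_i != 0.
Proof.
move=> xrG; apply/exists_inP; apply: contraR xrG => /exists_inPn H.
have [B _ freeB simB] := mx_rsim_standard rG.
have: ring_image x rG *m B = B *m ring_image x (standard_grepr rG).
  rewrite mulmx_suml mulmx_sumr; apply: eq_bigr => g Gg.
  by rewrite -scalemxAl -scalemxAr simB.
suff ->: ring_image x (standard_grepr rG) = 0.
  by rewrite mulmx0 -(mul0mx _ B) => /(row_free_inj freeB)->.
rewrite /standard_grepr; elim/big_rec: _ => [|W r _ IH].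
  by apply/matrixP=> - [].
rewrite ring_image_dadd IH; suff ->: ring_image x
    (muln_grepr (Representation (socle_repr W)) (standard_irr_coef rG W)) = 0.
  by rewrite block_mx0.
have [c0 | c0] := eqVneq (standard_irr_coef rG W) 0%N.
  by rewrite c0 /muln_grepr big_ord0; apply/matrixP=> - [].
have x0: ring_image x (socle_repr W) = 0.
  have:= H (irr_of_socle W); rewrite irr_of_socleK => H1; apply/eqP/negPn/H1.
  rewrite inE /= (cfRepr_sim (mx_rsim_standard rG)) cfRepr_standard.
  rewrite cfdot_suml (bigD1 (irr_of_socle W)) //= big1 => [|j ji].
    by rewrite addr0 cfdotZl cfnorm_irr mulr1 irr_of_socleK pnatr_eq0.
  by rewrite cfdotZl cfdot_irr (negPf ji) mulr0.
rewrite /muln_grepr; elim/big_rec: _ => [|j s _ IHs].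
  by apply/matrixP=> - [].
by rewrite ring_image_dadd IHs [ring_image x _]x0 block_mx0.
Qed.

End Constituents.

(** * Frobenius-Schur indicators twisted by a linear character *)

Lemma rank1_factor (F : fieldType) (m n : nat) (M : 'M[F]_(m, n)) :
  \rank M = 1%N -> {u : 'cV_m & {v : 'rV_n | M = u *m v}}.
Proof.
move=> rM; move: (col_base M) (row_base M) (mulmx_base M); rewrite rM => u v <-.
by exists u, v.
Qed.

Section TwistedFrobeniusSchur.

Variables (gT : finGroupType) (G : {group gT}) (n : nat).
Variable rG : mx_representation algC G n.
Hypothesis irrG : mx_irreducible rG.
Variable s : 'CF(G).
Hypotheses (lin_s : s \is a linear_char) (s_sq : forall g, g \in G -> s g * s g = 1).

Let chi := cfRepr rG.
Hypothesis chi_real : forall g, g \in G -> chi g^-1%g = chi g.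

Let nu := \sum_(g in G) s g * chi (g * g)%g.

Let n0 : n%:R != 0 :> algC.
Proof. by case/mx_abs_irrP: (groupC irrG) => n_gt0 _; rewrite pnatr_eq0 -lt0n. Qed.

Let chiE g : g \in G -> chi g = \tr (rG g).
Proof. by move=> Gg; rewrite /chi cfunE Gg mulr1n. Qed.

Let sV g : g \in G -> s g^-1%g = s g.
Proof.
move=> Gg; have sg0 : s g != 0.
  by apply/eqP=> s0; have := s_sq Gg; rewrite s0 mul0r => /esym/eqP; rewrite oner_eq0.
by apply: (mulIf sg0); rewrite -(lin_charM lin_s) ?groupV // mulVg lin_char1 // s_sq.
Qed.

Let chiC g : g \in G -> (chi g)^* = chi g.
Proof. by move=> Gg; rewrite -[RHS]chi_real // char_inv ?cfRepr_char. Qed.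

Lemma twisted_square_scalar : \sum_(g in G) s g *: rG (g * g)%g = (nu / n%:R)%:M.
Proof.
set Z := \sum_(g in G) _; rewrite [Z](irr_centraliser_scalar irrG) => [|h Gh].
  rewrite raddf_sum /=; congr (_ / _)%:M; apply: eq_bigr => g Gg.
  by rewrite mxtraceZ chiE ?groupM.
rewrite mulmx_sumr mulmx_suml (reindex_inj (conjg_inj h)) /=.
rewrite (eq_bigl (mem G)) => [|g]; last by rewrite /= groupJr.
apply: eq_bigr => g Gg; rewrite cfunJ // -scalemxAl -scalemxAr -conjMg.
by rewrite -!repr_mxM ?groupJ ?groupM // -conjgC.
Qed.

(** Substituting g h^-1 for g turns g h g into g^2 h^-1, and the sum of the
    s(g) g^2 is central. So X |-> sum of s(g) g X g is, up to the factor nu / n,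
    the linear extension of h |-> s(h) h^-1. *)
Lemma twisted_sandwich h : h \in G ->
  \sum_(g in G) s g *: (rG g *m rG h *m rG g) = (nu / n%:R * s h) *: rG h^-1%g.
Proof.
move=> Gh; rewrite (reindex_inj (mulIg h^-1%g)) /=.
rewrite (eq_bigl (mem G)) => [|g]; last by rewrite /= groupMr ?groupV.
transitivity (s h *: (\sum_(g in G) s g *: rG (g * g)%g) *m rG h^-1%g).
  rewrite scaler_sumr mulmx_suml; apply: eq_bigr => g Gg.
  rewrite -!repr_mxM ?groupM ?groupV // (lin_charM lin_s) ?groupV // sV //.
  rewrite scalerA -scalemxAl -repr_mxM ?groupM ?groupV // [s h * _]mulrC.
  by rewrite mulgKV mulgA.
by rewrite twisted_square_scalar -scalemxAl mul_scalar_mx scalerA mulrC.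
Qed.

(** Apply the sandwich map to the sum of the s(h) chi(h) h. It is scalar with
    trace proportional to '[s chi, chi], so it vanishes; its sandwich has trace
    proportional to nu '[chi]. *)
Lemma twisted_indicator0 : '[s * chi, chi] = 0 -> nu = 0.
Proof.
move=> ort.
have Mx0 : \sum_(h in G) (s h * chi h) *: rG h = 0.
  set M := \sum_(h in G) _; rewrite [M](irr_centraliser_scalar irrG) => [|h Gh].
    rewrite raddf_sum /= (eq_bigr (fun h => (s * chi) h * (chi h)^*)) => [|h Gh].
      move: ort; rewrite cfdotE => /eqP; rewrite mulf_eq0 invr_eq0 (negPf (neq0CG G)).
      by move=> /eqP ->; rewrite mul0r raddf0.
    by rewrite mxtraceZ [(s * chi) h]cfunE -chiE // chiC.
  rewrite mulmx_sumr mulmx_suml (reindex_inj (conjg_inj h)) /=.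
  rewrite (eq_bigl (mem G)) => [|g]; last by rewrite /= groupJr.
  apply: eq_bigr => g Gg; rewrite !cfunJ // -scalemxAl -scalemxAr.
  by rewrite -!repr_mxM ?groupJ ?groupM // -conjgC.
have: \sum_(h in G) (s h * chi h) *: \sum_(g in G) s g *: (rG g *m rG h *m rG g) = 0.
  transitivity (\sum_(g in G) s g *: (rG g *m (\sum_(h in G) (s h * chi h) *: rG h) *m rG g)).
    under eq_bigr do rewrite scaler_sumr.
    rewrite exchange_big; apply: eq_bigr => g Gg; rewrite mulmx_sumr mulmx_suml scaler_sumr.
    by apply: eq_bigr => h Gh; rewrite -scalemxAr -scalemxAl !scalerA mulrC.
  by rewrite Mx0; apply: big1 => g _; rewrite mulmx0 mul0mx scaler0.
move/(congr1 mxtrace); rewrite raddf_sum raddf0 /=.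
rewrite (eq_bigr (fun h => nu / n%:R * (chi h * (chi h)^*))) => [|h Gh]; last first.
  rewrite twisted_sandwich // !mxtraceZ -chiE ?groupV // chi_real // chiC //.
  transitivity ((s h * s h) * (nu / n%:R * (chi h * chi h))); first by ring.
  by rewrite s_sq // mul1r.
rewrite -mulr_sumr => /eqP; rewrite !mulf_eq0 invr_eq0 (negPf n0) orbF => /orP[/eqP // |].
have: '[chi] != 0.
  rewrite cfnorm_eq0; apply/eqP => /cfunP/(_ 1%g)/eqP.
  by rewrite cfRepr1 cfunE (negPf n0).
by rewrite cfdotE mulf_eq0 invr_eq0 (negPf (neq0CG G)) /= => /negPf->.
Qed.

(** Write M = u v and m(g) = tr(M g) = v g u. The sum of s(g) m(h1 g) m(g h2) is
    computed twice. The sandwich map gives nu delta m(h1) m(h2) / n. Reality of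
    chi and chi s = chi give m(g^-1) = delta s(g) m(g), which turns the second
    factor into m(h2^-1 g^-1) and the sum into a Schur average of value
    #|G| m(h1) m(h2) / n. *)
Lemma twisted_indicator1 (I : finType) (P : pred I) (x : I -> algC) (h : I -> gT)
    (delta : algC) (M := \sum_(i | P i) x i *: rG (h i)) :
  (forall i, P i -> h i \in G) -> (forall g, g \in G -> s g * chi g = chi g) ->
  delta * delta = 1 -> \rank M = 1%N ->
  \sum_(i | P i) (x i * s (h i)) *: rG (h i)^-1%g = delta *: M ->
  nu = #|G|%:R * delta.
Proof.
move=> Gh s_chi dd rM Mdag.
have sand : \sum_(g in G) s g *: (rG g *m M *m rG g) = (nu / n%:R * delta) *: M.
  rewrite -scalerA -Mdag scaler_sumr.
  transitivity (\sum_(i | P i) x i *: \sum_(g in G) s g *: (rG g *m rG (h i) *m rG g)).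
    under [RHS]eq_bigr do rewrite scaler_sumr.
    rewrite [RHS]exchange_big; apply: eq_bigr => g Gg.
    rewrite mulmx_sumr mulmx_suml scaler_sumr; apply: eq_bigr => i Pi.
    by rewrite -scalemxAr -scalemxAl !scalerA [s g * _]mulrC.
  apply: eq_bigr => i Pi; rewrite twisted_sandwich ?Gh // !scalerA.
  by congr (_ *: _); ring.
pose m g := \tr (M *m rG g).
have mV g : g \in G -> m g^-1%g = delta * s g * m g.
  move=> Gg; rewrite mulrAC -mxtraceZ scalemxAl -Mdag mulmx_suml raddf_sum mulr_suml.
  rewrite /m /M mulmx_suml raddf_sum; apply: eq_bigr => i Pi /=.
  have Ghi := Gh i Pi.
  rewrite -!scalemxAl !mxtraceZ [in RHS]mxtrace_mulC -!repr_mxM ?groupV //.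
  rewrite -!chiE ?groupM ?groupV // -chi_real ?groupM ?groupV // invMg invgK.
  rewrite -[in LHS]s_chi ?groupM ?groupV // (lin_charM lin_s) ?groupV // sV //.
  by ring.
have [u [v Euv]] := rank1_factor rM.
have mE g : m g = (v *m rG g *m u) 0 0.
  by rewrite /m Euv -[u *m v *m _]mulmxA mxtrace_mulC /mxtrace big_ord1.
have sc g : v *m rG g *m u = (m g)%:M by rewrite mE -mx11_scalar.
(* First evaluation, by the sandwich map: it multiplies M by nu delta / n. *)
have F1 h1 h2 : h1 \in G -> h2 \in G ->
    \sum_(g in G) s g * (m (h1 * g)%g * m (g * h2)%g)
      = nu / n%:R * delta * (m h1 * m h2).
  move=> G1 G2.
  have: v *m rG h1 *m (\sum_(g in G) s g *: (rG g *m M *m rG g)) *m (rG h2 *m u)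
     = (nu / n%:R * delta * (m h1 * m h2))%:M.
    rewrite sand -scalemxAr -scalemxAl Euv !mulmxA sc -!mulmxA [v *m _]mulmxA sc.
    by rewrite mul_scalar_mx scale_scalar_mx scale_scalar_mx.
  rewrite mulmx_sumr mulmx_suml => /matrixP/(_ 0 0); rewrite [RHS]mxE eqxx mulr1n => <-.
  rewrite summxE; apply: eq_bigr => g Gg.
  rewrite -scalemxAr -scalemxAl mxE; congr (_ * _).
  rewrite Euv !mulmxA -[v *m _ *m rG g]mulmxA -repr_mxM // sc -!mulmxA.
  by rewrite [rG g *m _]mulmxA -repr_mxM // [v *m _]mulmxA sc mul_scalar_mx !mxE eqxx !mulr1n.
(* Second evaluation, by the Schur average of M h2^-1. *)
have F2 h1 h2 : h1 \in G -> h2 \in G ->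
    \sum_(g in G) s g * (m (h1 * g)%g * m (g * h2)%g)
      = #|G|%:R / n%:R * (m h1 * m h2).
  move=> G1 G2.
  have E : (v *m rG h1 *m (\sum_(g in G) rG g *m (M *m rG h2^-1%g) *m rG g^-1%g) *m u) 0 0
      = #|G|%:R * (delta * s h2 * m h2) / n%:R * m h1.
    rewrite (schur_average irrG) -/(m _) mV // mul_mx_scalar -scalemxAl sc.
    by rewrite scale_scalar_mx mxE eqxx mulr1n.
  rewrite mulmx_sumr mulmx_suml summxE in E.
  have -> : #|G|%:R / n%:R * (m h1 * m h2)
      = delta * s h2 * (#|G|%:R * (delta * s h2 * m h2) / n%:R * m h1).
    transitivity ((delta * delta) * (s h2 * s h2) * (#|G|%:R / n%:R * (m h1 * m h2))).
      by rewrite dd s_sq // !mul1r.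
    by ring.
  rewrite -E mulr_sumr; apply: eq_bigr => g Gg.
  rewrite Euv !mulmxA -[v *m _ *m rG g]mulmxA -repr_mxM // sc -!mulmxA.
  rewrite [rG h2^-1%g *m _]mulmxA -repr_mxM ?groupV // -invMg [v *m _]mulmxA sc.
  rewrite mul_scalar_mx !mxE eqxx !mulr1n mV ?groupM // (lin_charM lin_s) //.
  transitivity ((delta * delta) * (s h2 * s h2) * (s g * (m (h1 * g)%g * m (g * h2)%g))).
    by rewrite dd s_sq // !mul1r.
  by ring.
have [k Gk mk0] : exists2 k, k \in G & m k != 0.
  have M0 : M != 0 by rewrite -mxrank_eq0 rM.
  have /matrix0Pn[i [j Mij]] := M0.
  have trB : \tr (M *m delta_mx j i) != 0.
    rewrite -(mul_delta_mx (0 : 'I_1)) mulmxA mxtrace_mulC mulmxA -rowE -colE.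
    by rewrite /mxtrace big_ord1 !mxE.
  have [g Gg] := exists_link irrG M0 trB; rewrite mulmxA => ne; exists g => //.
  apply: contraNneq ne => mg0.
  rewrite Euv !mulmxA -[u *m v *m _]mulmxA -[u *m (v *m _) *m u]mulmxA sc mg0.
  by rewrite raddf0 mulmx0 !mul0mx.
have /(mulIf (mulf_neq0 mk0 mk0)) : #|G|%:R / n%:R * (m k * m k) = nu / n%:R * delta * (m k * m k).
  by rewrite -F1 ?F2.
rewrite mulrAC => /(mulIf (invr_neq0 n0)) E.
by rewrite E -mulrA dd mulr1.
Qed.

End TwistedFrobeniusSchur.

(** * Point stabilisers in symmetric groups *)

Notation SymG := (@perm.Sym_group _).

Lemma natr_card_setId (R : pzSemiRingType) (T : finType) (S : {set T}) (P : pred T) :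
  #|[set x in S | P x]|%:R = \sum_(x in S) (P x)%:R :> R.
Proof.
rewrite -sumr_const big_mkcond [RHS]big_mkcond; apply: eq_bigr => x _.
by rewrite inE; case: (x \in S) => //=; case: (P x).
Qed.

Section PointStabilisers.

Variable n : nat.
Implicit Types (A B : {set 'I_n}) (H : {group 'S_n}) (s g h y : 'S_n).

Lemma sign_cfunE H s : s \in H -> sign_cfun H s = (-1) ^+ s.
Proof. by move=> Hs; rewrite cfunE Hs. Qed.

Lemma sign_mx_repr H : mx_repr H (fun s => ((-1) ^+ s)%:M : 'M[algC]_1).
Proof.
split=> [|s t _ _]; first by rewrite odd_perm1.
by rewrite odd_permM -scalar_mxM signr_addb.
Qed.

Lemma sign_cfun_lin H : sign_cfun H \is a linear_char.
Proof.
rewrite qualifE /= sign_cfunE // odd_perm1 eqxx andbT.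
suff ->: sign_cfun H = cfRepr (MxRepresentation (sign_mx_repr H)) by exact: cfRepr_char.
apply/cfun_inP=> s Hs; rewrite sign_cfunE // cfunE Hs.
by rewrite /mxtrace big_ord1 mxE eqxx.
Qed.

Lemma sign_cfun_sq H s : s \in H -> sign_cfun H s * sign_cfun H s = 1.
Proof. by move=> Hs; rewrite sign_cfunE // -expr2 sqrr_sign. Qed.

Definition num_fixed A s : algC := (#|[set a in A | s a == a]|)%:R.

Lemma num_fixedE A s : num_fixed A s = \sum_(a in A) (s a == a)%:R.
Proof.
exact: natr_card_setId.
Qed.

Lemma Sym_perm_on A s : (s \in SymG A) = perm_on A s.
Proof. by rewrite inE. Qed.

Lemma Sym_out A s a : s \in SymG A -> a \notin A -> s a = a.
Proof. by rewrite Sym_perm_on => /out_perm; apply. Qed.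

Lemma Sym_D1 A a s : (s \in SymG (A :\ a)) = (s \in SymG A) && (s a == a).
Proof.
rewrite !inE; apply/subsetP/andP=> [sAa | [/subsetP sA /eqP sa] x].
  split; first by apply/subsetP=> x /sAa; rewrite inE => /andP[].
  by apply: contraT => sa; have /sAa := (sa : a \in [pred x | s x != x]); rewrite !inE eqxx.
rewrite inE => sx; rewrite !inE (sA x) // andbT.
by apply: contraNneq sx => ->; rewrite sa.
Qed.

Lemma Sym_sub A B : A \subset B -> SymG A \subset SymG B.
Proof.
by move=> sAB; apply/subsetP=> s; rewrite !inE => /subset_trans; apply.
Qed.

Lemma tperm_Sym A a b : a \in A -> b \in A -> tperm a b \in SymG A.
Proof.
move=> Aa Ab; rewrite inE; apply: subset_trans (tperm_on a b) _.
by apply/subsetP=> x; rewrite !inE => /orP[] /eqP->.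
Qed.

Lemma Sym_closed A s a : s \in SymG A -> (s a \in A) = (a \in A).
Proof. by rewrite inE => /perm_closed. Qed.

Lemma card_Sym_D1 A a : a \in A -> #|SymG A| = (#|A| * #|SymG (A :\ a)|)%N.
Proof. by move=> Aa; rewrite !perm.card_Sym (cardsD1 a A) Aa /= factS. Qed.

Lemma num_fixedJ A s y : y \in SymG A -> num_fixed A (s ^ y) = num_fixed A s.
Proof.
move=> Sy; rewrite !num_fixedE (reindex_inj (@perm_inj _ y)) /=.
apply: eq_big => [a|a _]; first by rewrite Sym_closed.
by rewrite permJ (inj_eq perm_inj).
Qed.

(** Count pairs of g and a fixed point c of g: each c contributes the same sum,
    since a transposition conjugates the stabiliser of a to that of c. *)
Lemma sum_num_fixed A a (F : 'S_n -> algC) : a \in A ->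
    {in SymG A &, forall g h, F (g ^ h)%g = F g} ->
  #|SymG A|%:R^-1 * \sum_(g in SymG A) F g * num_fixed A g
    = #|SymG (A :\ a)|%:R^-1 * \sum_(g in SymG (A :\ a)) F g.
Proof.
move=> Aa FJ; have A0 : #|A|%:R != 0 :> algC.
  by rewrite pnatr_eq0 -lt0n; apply/card_gt0P; exists a.
rewrite (card_Sym_D1 Aa) natrM invfM -mulrA mulrCA; congr (_ * _).
apply: (canLR (mulKf A0)).
under eq_bigr do rewrite num_fixedE mulr_sumr.
rewrite exchange_big (eq_bigr (fun=> \sum_(g in SymG (A :\ a)) F g)) => [|c Ac].
  by rewrite sumr_const mulr_natl.
set t := tperm a c; have St : t \in SymG A := tperm_Sym Aa Ac.
have tac : t a = c by rewrite tpermL.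
rewrite (reindex_inj (conjg_inj t)) big_mkcond [RHS]big_mkcond /=.
apply: eq_bigr => g _; rewrite Sym_D1 groupJr //; case Sg: (g \in _) => //=.
rewrite FJ // -tac permJ (inj_eq perm_inj).
by case: eqP; rewrite ?mulr1 ?mulr0.
Qed.

(** Let c be the point that y maps to a. The conjugate h ^ y lies in the
    stabiliser exactly if h fixes c, and then h commutes with the transposition
    of a and c, which carries y into the stabiliser; so phi (h ^ y) = phi h. *)
Lemma cfInd_point_stabiliser A a (phi : 'CF(SymG (A :\ a))) h :
  a \in A -> h \in SymG (A :\ a) ->
  'Ind[SymG A] phi h = phi h * num_fixed A h.
Proof.
move=> Aa Hh; have sHG := Sym_sub (subD1set A a).
rewrite cfIndE // num_fixedE [in RHS]mulr_sumr.
apply: (canLR (mulKf (neq0CG (SymG (A :\ a))))); rewrite mulr_sumr.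
rewrite (partition_big (fun y : 'S_n => (y^-1)%g a) (mem A)) /=; last first.
  by move=> y Sy; rewrite Sym_closed // groupV.
apply: eq_bigr => c Ac; set t := tperm a c; have St : t \in SymG A := tperm_Sym Aa Ac.
have tac : t a = c by rewrite tpermL.
rewrite (reindex_inj (mulgI t)) /=.
rewrite (eq_bigl (mem (SymG (A :\ a)))) => [|y]; last first.
  rewrite /= Sym_D1 groupMl //; congr (_ && _).
  rewrite invMg permM tpermV -/t -{1}tac (inj_eq perm_inj).
  by rewrite -[LHS](inj_eq (@perm_inj _ y)) permKV eq_sym.
rewrite (eq_bigr (fun=> phi h * (h c == c)%:R)) => [|y Hy].
  by rewrite sumr_const mulr_natl.
move: Hh; rewrite Sym_D1 => /andP[Sh /eqP ha].
have [hc | hc] := eqVneq (h c) c; last first.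
  rewrite mulr0 cfun0 // Sym_D1 negb_and; apply/orP; right.
  apply: contraNneq hc => E; have tca : t c = a by rewrite tpermR.
  have := Hy : y \in SymG (A :\ a); rewrite Sym_D1 => /andP[_ /eqP ya].
  have: ((h ^ t) ^ y)%g (y (t c)) = y (t (h c)) by rewrite !permJ.
  by rewrite -conjgM tca ya E -{1}ya -{1}tca => /perm_inj/perm_inj <-.
have tJ : (t ^ h)%g = t by rewrite /t tpermJ ha hc.
have ht : (h ^ t)%g = h by rewrite conjgE [(h * t)%g](_ : _ = t * h)%g ?mulKg // [in RHS]conjgC tJ.
by rewrite conjgM ht cfunJ // mulr1.
Qed.

Definition fixed_subproof A : is_class_fun <<SymG A>>%g
  [ffun s => num_fixed A s *+ (s \in SymG A)].
Proof.
rewrite genGid; apply: intro_class_fun => [s t Hs Ht | s /negPf-> //].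
by rewrite groupJ // Hs num_fixedJ.
Qed.
Definition fixed_cfun A : 'CF(SymG A) := Cfun 0 (fixed_subproof A).

Lemma fixed_cfunE A s : s \in SymG A -> fixed_cfun A s = num_fixed A s.
Proof. by move=> Ss; rewrite cfunE Ss. Qed.

(** Multiplication by the permutation character is restriction to a point
    stabiliser followed by induction. *)
Lemma cfdot_fixed A a (phi psi : 'CF(SymG A)) : a \in A ->
  '[phi * fixed_cfun A, psi] = '['Res[SymG (A :\ a)] phi, 'Res psi].
Proof.
move=> Aa; rewrite !cfdotE.
transitivity (#|SymG A|%:R^-1 *
    \sum_(g in SymG A) (phi g * (psi g)^* ) * num_fixed A g).
  congr (_ * _); apply: eq_bigr => g Sg.
  by rewrite [(phi * _) g]cfunE fixed_cfunE // mulrAC.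
rewrite (sum_num_fixed Aa) => [|g h Sg Sh]; last by rewrite !cfunJ.
congr (_ * _); apply: eq_bigr => g Sg.
by rewrite !cfResE ?(Sym_sub (subD1set A a)).
Qed.

Lemma fixed_cfun_Ind A a : a \in A -> fixed_cfun A = 'Ind[SymG A] (1 : 'CF(SymG (A :\ a))).
Proof.
move=> Aa; apply/eqP; rewrite -subr_eq0 -cfnorm_eq0; apply/eqP.
set X := _ - _; rewrite {1}/X cfdotBl -{1}[fixed_cfun A]mul1r (cfdot_fixed _ _ Aa).
by rewrite cfRes_cfun1 -Frobenius_reciprocity subrr.
Qed.

(** The instance of Mackey's formula that drives the induction in the branching
    rule. *)
Lemma cfnorm_Ind_point_stabiliser A a (phi : 'CF(SymG (A :\ a))) : a \in A ->
  '['Ind[SymG A] phi] = '[phi] + '[phi, phi * fixed_cfun (A :\ a)].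
Proof.
move=> Aa; rewrite -cfdot_Res_r -cfdotDr; congr '[_, _].
apply/cfun_inP=> h Hh; rewrite cfResE ?(Sym_sub (subD1set A a)) //.
rewrite cfInd_point_stabiliser // [in RHS]cfunE [(phi * _) h]cfunE fixed_cfunE //.
move: Hh; rewrite Sym_D1 => /andP[_ /eqP ha].
rewrite !num_fixedE (big_setD1 a) //= ha eqxx.
by rewrite mulrDr mulr1.
Qed.

End PointStabilisers.

(** * Young diagrams and their fillings *)

Section Shapes.

Variable n : nat.
Notation box := ('I_n * 'I_n)%type.
Implicit Types (A : {set 'I_n}) (D E : {set box}) (t : 'I_n -> box).

Lemma card_ord_lt k : (k <= n)%N -> #|[set i : 'I_n | (i < k)%N]| = k.
Proof.
move=> le_kn; rewrite -[RHS]card_ord -(card_codom (f := widen_ord le_kn)); last first.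
  by move=> i j /(congr1 val)/= /val_inj.
apply: eq_card => i; rewrite !inE; apply/idP/codomP=> [lt_ik | [j ->] //=].
by exists (Ordinal lt_ik); apply: val_inj.
Qed.

(** This determines a row of a diagram from its length. *)
Lemma initial_segmentE (J : {set 'I_n}) : {in J, forall j i : 'I_n, (i <= j)%N -> i \in J} ->
  forall j, (j \in J) = (j < #|J|)%N.
Proof.
move=> dJ j; apply/idP/idP=> [Jj | ltj].
  rewrite -[X in (X <= _)%N](card_ord_lt (ltn_ord j)); apply/subset_leq_card.
  by apply/subsetP=> i; rewrite inE ltnS => /(dJ j Jj).
apply: contraLR ltj => J'j; rewrite -leqNgt -[X in (_ <= X)%N](card_ord_lt (ltnW (ltn_ord j))).
apply/subset_leq_card/subsetP=> i Ji; rewrite inE ltnNge.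
by apply: contra J'j; apply: dJ.
Qed.

Definition young D :=
  [forall b in D, forall c : box, (c.1 <= b.1)%N && (c.2 <= b.2)%N ==> (c \in D)].

Lemma youngP D :
  reflect (forall b c : box, b \in D -> (c.1 <= b.1)%N -> (c.2 <= b.2)%N -> c \in D)
          (young D).
Proof.
apply: (iffP forall_inP) => [yD b c Db le1 le2 | yD b Db].
  by have /forallP/(_ c)/implyP := yD b Db; rewrite le1 le2; apply.
by apply/forallP=> c; apply/implyP=> /andP[]; apply: yD.
Qed.

Lemma young_row D (b : box) :
  young D -> (b \in D) = (b.2 < #|[set c in D | c.1 == b.1]|)%N.
Proof.
move=> /youngP yD; pose J := [set j | (b.1, j) \in D].
have -> : #|[set c in D | c.1 == b.1]| = #|J|.
  have inj : injective (fun j : 'I_n => (b.1, j)) by move=> j k [].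
  rewrite -(card_imset _ inj); apply: eq_card => -[i j]; rewrite !inE /=.
  apply/andP/imsetP=> [[Dc /eqP e] | [k]]; first by exists j; rewrite ?inE -e.
  by rewrite inE => Dk [-> ->].
rewrite -initial_segmentE => [|j]; first by rewrite inE -surjective_pairing.
by rewrite inE => Dj i le_ij; rewrite inE; apply: yD Dj _ _.
Qed.

Definition rows_below D k := #|[set b in D | (b.1 < k)%N]|.

Lemma rows_belowS D (i : 'I_n) :
  rows_below D i.+1 = (rows_below D i + #|[set c in D | c.1 == i]|)%N.
Proof.
rewrite /rows_below -cardsUI (_ : _ :&: _ = set0) ?cards0 ?addn0.
  apply: eq_card => b; rewrite !inE -andb_orr ltnS leq_eqVlt orbC; congr (_ && (_ || _)).
by apply/setP=> b; rewrite !inE; case: eqP => [->|_]; rewrite ?ltnn !andbF.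
Qed.

(** Differences of consecutive counts are the row lengths. *)
Lemma young_inj D E : young D -> young E ->
  (forall k, rows_below D k = rows_below E k) -> D = E.
Proof.
move=> yD yE eqDE; apply/setP=> b; rewrite !young_row //.
have := eqDE b.1.+1; rewrite !rows_belowS eqDE.
by move/addnI->.
Qed.

(** A tableau without order conditions: t is only relevant on A, and keeping it a
    total function makes restriction to a smaller A free. *)
Definition filling A D t := {in A &, injective t} /\ t @: A = D.

Lemma card_filling A D t : filling A D t -> #|D| = #|A|.
Proof. by move=> [inj <-]; rewrite card_in_imset. Qed.

Lemma card_filling_pred A D t (P : pred box) : filling A D t ->
  #|[set a in A | P (t a)]| = #|[set b in D | P b]|.
Proof.
move=> [inj <-]; rewrite -(@card_in_imset _ _ t) => [|a b]; last first.
  by rewrite !inE => /andP[Aa _] /andP[Ab _]; apply: inj.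
apply: eq_card => b; rewrite !inE; apply/imsetP/andP=> [[a] | [/imsetP[a Aa ->] Pa]].
  by rewrite inE => /andP[Aa Pa] ->; rewrite imset_f.
by exists a => //; rewrite inE Aa.
Qed.

Section RowColumn.

Variables (A : {set 'I_n}) (D E : {set box}) (t u : 'I_n -> box).
Hypotheses (yE : young E) (tD : filling A D t) (uE : filling A E u).
Hypothesis inj_tu : {in A &, injective (fun a => ((t a).1, (u a).2))}.

(** In column j of u the points have pairwise different rows in t. If that column
    reaches row k, then u has the maximal number k of points above that row;
    otherwise all its points lie above it in u. *)
Lemma column_count_le (j : 'I_n) k :
  (#|[set a in A | ((u a).2 == j) && ((t a).1 < k)%N]|
    <= #|[set a in A | ((u a).2 == j) && ((u a).1 < k)%N]|)%N.
Proof.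
have [/existsP[a0 /and3P[Aa0 /eqP ja0 le_k]] | /existsPn small] :=
    boolP [exists a, [&& a \in A, (u a).2 == j & (k <= (u a).1)%N]].
  rewrite (card_filling_pred (fun b => (b.2 == j) && (b.1 < k)%N) uE).
  have le_kn : (k <= n)%N by apply: leq_trans le_k (ltnW (ltn_ord _)).
  apply: (@leq_trans #|[set i : 'I_n | (i < k)%N]|).
    rewrite -[X in (X <= _)%N](@card_in_imset _ _ (fun a => (t a).1)) => [|a b]; last first.
      rewrite !inE => /and3P[Aa /eqP ja _] /and3P[Ab /eqP jb _] e.
      by apply: inj_tu; rewrite // e ja jb.
    apply/subset_leq_card/subsetP=> i /imsetP[a].
    by rewrite !inE => /and3P[_ _ lt] ->.
  have inj : injective (fun i : 'I_n => (i, j)) by move=> i1 i2 [].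
  rewrite -(card_imset _ inj); apply/subset_leq_card/subsetP=> b /imsetP[i].
  rewrite !inE => lt_ik -> /=; rewrite eqxx lt_ik !andbT.
  move/youngP: yE => /(_ (u a0) (i, j)); apply; rewrite /= ?ja0 //.
    by case: uE => _ <-; rewrite imset_f.
  by apply: leq_trans le_k; apply: ltnW.
apply/subset_leq_card/subsetP=> a; rewrite !inE => /and3P[Aa ja _].
have := small a; rewrite Aa ja /= -ltnNge => ->; by [].
Qed.

Lemma rows_below_columns (v : 'I_n -> box) (F : {set box}) k : filling A F v ->
  rows_below F k = (\sum_(j : 'I_n) #|[set a in A | ((u a).2 == j) && ((v a).1 < k)%N]|)%N.
Proof.
move=> vF; rewrite /rows_below -(card_filling_pred (fun b => (b.1 < k)%N) vF).
rewrite -sum1_card (partition_big (fun a => (u a).2) xpredT) //=.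
apply: eq_bigr => j _; rewrite sum1dep_card; apply: eq_card => a.
by rewrite !inE -andbA; congr (_ && _); rewrite andbC.
Qed.

(** The dominance order: sum the previous bound over the columns of u. *)
Lemma rows_below_le k : (rows_below D k <= rows_below E k)%N.
Proof.
rewrite (rows_below_columns k tD) (rows_below_columns k uE).
by apply: leq_sum => j _; apply: column_count_le.
Qed.

(** When the diagrams agree the bounds on the columns add up to an equality, so each
    of them is one. If the box were outside E, then every point of its column would lie
    above row (t a).1 in u, hence by equality in t as well, and a itself does not. *)
Lemma row_column_mem : D = E -> {in A, forall a, ((t a).1, (u a).2) \in E}.
Proof.
move=> eDE a Aa; set j := (u a).2; set k := (t a).1.
have /eqP : rows_below D k = rows_below E k by rewrite eDE.
rewrite (rows_below_columns k tD) (rows_below_columns k uE).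
have le j' := leqif_eq (column_count_le j' k).
rewrite (leqif_sum (fun j' _ => le j')) => /forall_inP/(_ j isT)/eqP e.
apply: contraT => kjE.
have sub : [set b in A | ((u b).2 == j) && ((t b).1 < k)%N] \subset [set b in A | (u b).2 == j].
  by apply/subsetP=> b; rewrite !inE => /and3P[-> ->].
have : [set b in A | ((u b).2 == j) && ((t b).1 < k)%N] == [set b in A | (u b).2 == j].
  rewrite eqEcard sub e; apply/subset_leq_card/subsetP=> b; rewrite !inE => /andP[Ab jb].
  rewrite Ab jb ltnNge; apply: contra kjE => le_k.
  move/youngP: yE => /(_ (u b) (k, j)); apply; rewrite //= ?(eqP jb) //.
  by case: uE => _ <-; rewrite imset_f.
by move/eqP/setP/(_ a); rewrite !inE Aa eqxx ltnn.
Qed.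

End RowColumn.

End Shapes.

(** * Row and column multiplicities of a filling *)

Section Labels.

Variable n : nat.
Notation box := ('I_n * 'I_n)%type.
Implicit Types (A : {set 'I_n}) (D E : {set box}) (t u : 'I_n -> box).
Implicit Types (f : 'I_n -> 'I_n) (s y p : 'S_n).

(** The permutations of A that keep each fibre of f. The condition is void outside
    A, where they are the identity. *)
Definition line_stab A f : {set 'S_n} :=
  [set s in SymG A | [forall k, f (s k) == f k]].

Lemma line_stabP A f s :
  reflect (s \in SymG A /\ forall k, f (s k) = f k) (s \in line_stab A f).
Proof.
apply: (iffP setIdP) => -[Ss fs]; split=> //.
  by move=> k; exact/eqP/(forallP fs).
by apply/forallP=> k; rewrite fs.
Qed.

Lemma line_stab_group_set A f : group_set (line_stab A f).
Proof.
apply/group_setP; split=> [|s y]; first by apply/line_stabP; split=> [|k]; rewrite ?group1 ?perm1.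
move=> /line_stabP[Ss fs] /line_stabP[Sy fy]; apply/line_stabP.
by split=> [|k]; rewrite ?groupM // permM fy fs.
Qed.
Canonical line_stab_group A f := Group (line_stab_group_set A f).

Lemma line_stab_sub A f : line_stab A f \subset SymG A.
Proof. by apply/subsetP=> s /line_stabP[]. Qed.

Definition row_stabiliser A t := line_stab_group A (fun a => (t a).1).
Definition col_stabiliser A t := line_stab_group A (fun a => (t a).2).

Lemma line_stab_Sym A f s : s \in SymG A ->
  (s \in line_stab A f) = [forall k in A, f (s k) == f k].
Proof.
move=> Ss; apply/line_stabP/forall_inP=> [[_ fs] k _ | fs]; first by rewrite fs.
split=> // k; have [/fs/eqP // | A'k] := boolP (k \in A).
by rewrite (Sym_out Ss A'k).
Qed.

Lemma Sym_eq1 A s : s \in SymG A -> {in A, forall a, s a = a} -> s = 1%g.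
Proof.
move=> Ss sA; apply/permP=> a; rewrite perm1; have [/sA // | A'a] := boolP (a \in A).
by rewrite (Sym_out Ss A'a).
Qed.

Lemma filling_perm A D t u : filling A D t -> filling A D u ->
  exists2 p, p \in SymG A & {in A, forall a, t (p a) = u a}.
Proof.
move=> [inj_t tA] [inj_u uA].
pose q a := if a \in A then odflt a [pick b in A | t b == u a] else a.
have qP a : a \in A -> q a \in A /\ t (q a) = u a.
  move=> Aa; rewrite /q Aa; case: pickP => [b /andP[Ab /eqP] // | no].
  have: u a \in t @: A by rewrite tA -uA imset_f.
  by case/imsetP=> b Ab e; have:= no b; rewrite Ab e eqxx.
have inj_q : injective q.
  move=> a b e; case: (boolP (a \in A)) (boolP (b \in A)) => [Aa|A'a] [Ab|A'b].
  - have [_ ta] := qP a Aa; have [_ tb] := qP b Ab.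
    by apply: inj_u => //; rewrite -ta -tb e.
  - by have [qa _] := qP a Aa; move: qa A'b; rewrite e /q; case: ifP => // ->.
  - by have [qb _] := qP b Ab; move: qb A'a; rewrite -e /q; case: ifP => // ->.
  by move: e; rewrite /q (negPf A'a) (negPf A'b).
exists (perm inj_q) => [|a Aa]; last by rewrite permE; have [] := qP a Aa.
rewrite inE; apply/subsetP=> a; rewrite inE permE /q.
by case: ifP => //; rewrite eqxx.
Qed.

Lemma filling_comp A D t y : filling A D t -> y \in SymG A -> filling A D (fun a => t (y a)).
Proof.
move=> [inj_t tA] Sy; split=> [a b Aa Ab /inj_t|].
  by rewrite !(Sym_closed _ Sy) => /(_ Aa Ab)/perm_inj.
by rewrite Sym_perm_on in Sy; rewrite -tA -[in RHS](im_perm_on Sy) -imset_comp.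
Qed.

Definition row_mult A t (chi : 'CF(SymG A)) := '['Res[row_stabiliser A t] chi, 1].
Definition col_mult A t (chi : 'CF(SymG A)) :=
  '['Res[col_stabiliser A t] chi, sign_cfun (col_stabiliser A t)].

Lemma row_multE A t (chi : 'CF(SymG A)) : row_mult t chi =
  #|row_stabiliser A t|%:R^-1 * \sum_(g in row_stabiliser A t) chi g.
Proof.
rewrite /row_mult cfdotE; congr (_ * _); apply: eq_bigr => g Rg.
by rewrite cfResE ?line_stab_sub // cfun1E Rg conjC1 mulr1.
Qed.

Lemma col_multE A t (chi : 'CF(SymG A)) : col_mult t chi =
  #|col_stabiliser A t|%:R^-1 * \sum_(g in col_stabiliser A t) (-1) ^+ g * chi g.
Proof.
rewrite /col_mult cfdotE; congr (_ * _); apply: eq_bigr => g Rg.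
by rewrite cfResE ?line_stab_sub // sign_cfunE // rmorph_sign mulrC.
Qed.

Lemma row_mult_nat A t (i : Iirr (SymG A)) : row_mult t 'chi_i \in Num.nat.
Proof. by rewrite Cnat_cfdot_char ?cfRes_char ?irr_char ?rpred1. Qed.

Lemma col_mult_nat A t (i : Iirr (SymG A)) : col_mult t 'chi_i \in Num.nat.
Proof.
by rewrite Cnat_cfdot_char ?cfRes_char ?irr_char ?lin_charW ?sign_cfun_lin.
Qed.

(** Two points sharing a row and a column can be exchanged. *)
Lemma common_stab_tperm A f g : ~ {in A &, injective (fun a => (f a, g a))} ->
  exists2 c, c \in line_stab A g :&: line_stab A f & odd_perm c.
Proof.
move=> noninj.
have [a [b [Aa Ab ab [eqf eqg]]]] : exists a, exists b,
    [/\ a \in A, b \in A, a != b & f a = f b /\ g a = g b].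
  have: ~~ [forall a in A, forall b in A, (f a == f b) && (g a == g b) ==> (a == b)].
    apply/negP=> H; apply: noninj => a b Aa Ab [e1 e2]; apply/eqP.
    have := forall_inP (forall_inP H a Aa) b Ab; rewrite e1 e2 !eqxx; exact.
  rewrite negb_forall_in => /exists_inP[a Aa]; rewrite negb_forall_in => /exists_inP[b Ab].
  by rewrite negb_imply => /andP[/andP[/eqP e1 /eqP e2] ab]; exists a, b.
have Lt h : h a = h b -> tperm a b \in line_stab A h.
  move=> e; apply/line_stabP; split=> [|k]; first exact: tperm_Sym.
  by case: tpermP => [->|->|].
by exists (tperm a b); rewrite ?odd_tperm // in_setI !Lt.
Qed.

(** Without a shared pair only the identity keeps rows and columns; with one, the
    transposition pairs off terms of opposite sign. *)
Lemma sum_sign_common_stab A f g :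
  \sum_(c in line_stab A g :&: line_stab A f) (-1) ^+ c
    = (dinjectiveb (fun a => (f a, g a)) (mem A))%:R :> algC.
Proof.
case: dinjectiveP => [inj | /common_stab_tperm[t Ht odd_t]].
  rewrite (big_pred1 1%g) ?odd_perm1 // => c; rewrite inE /=.
  apply/andP/eqP=> [[/line_stabP[Sc gc] /line_stabP[_ fc]] | ->]; last by rewrite !group1.
  by apply: (Sym_eq1 Sc) => a Aa; apply: inj; rewrite ?inE ?(Sym_closed _ Sc) ?gc ?fc.
set S := \sum_(c in _) _; have : S = - S.
  rewrite {1}/S (reindex_inj (mulgI t)) /= -sumrN.
  apply: eq_big => [c | c _]; first by rewrite -[_ :&: _]/(gval (_ :&: _)%G) groupMl.
  by rewrite odd_permM odd_t signr_addb mulN1r.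
by move/eqP; rewrite -addr_eq0 -mulr2n mulrn_eq0 => /eqP.
Qed.

(** By Frobenius reciprocity the left side is an inner product of two induced
    characters. Expanding both gives, for each y, the sum of the signs of the
    permutations that keep the columns of u and the rows of t composed with y. *)
Lemma sum_row_col_mult A t u :
  \sum_(i : Iirr (SymG A)) row_mult t 'chi_i * col_mult u 'chi_i
   = #|row_stabiliser A t|%:R^-1 * #|col_stabiliser A u|%:R^-1
     * #|[set y in SymG A | dinjectiveb (fun a => ((t (y a)).1, (u a).2)) (mem A)]|%:R.
Proof.
transitivity '['Ind[SymG A] (1 : 'CF(row_stabiliser A t)),
               'Ind[SymG A] (sign_cfun (col_stabiliser A u))].
  rewrite cfdot_sum_irr; apply: eq_bigr => i _; congr (_ * _).
    by rewrite -Frobenius_reciprocity cfdotC_char ?cfRes_char ?irr_char ?rpred1.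
  by rewrite -cfdotC -cfdot_Res_l.
rewrite -cfdot_Res_l cfdotE [_^-1 * _^-1]mulrC -mulrA; congr (_ * _).
transitivity (\sum_(c in col_stabiliser A u) #|row_stabiliser A t|%:R^-1 *
   \sum_(y in SymG A) (c \in line_stab A (fun a => (t (y a)).1))%:R * (-1) ^+ c : algC).
  apply: eq_bigr => c Cc; have [Sc _] := line_stabP _ _ _ Cc.
  rewrite cfResE ?line_stab_sub // cfIndE ?line_stab_sub // sign_cfunE // rmorph_sign.
  rewrite -mulrA mulr_suml; congr (_ * _); apply: eq_bigr => y Sy; rewrite cfun1E.
  congr (_%:R * _); congr (nat_of_bool _); apply/line_stabP/line_stabP=> -[_ rc]; split.
  - by [].
  - by move=> k; have := rc (y k); rewrite permJ.
  - by rewrite groupJ.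
  by move=> k; rewrite -(permKV y k) permJ rc.
rewrite -mulr_sumr; congr (_ * _); rewrite exchange_big.
rewrite -sum1_card natr_sum big_mkcond [RHS]big_mkcond /=; apply: eq_bigr => y _.
rewrite !inE; case: (perm_on A y) => //=.
transitivity (\sum_(c in line_stab A (fun a => (u a).2) :&:
    line_stab A (fun a => (t (y a)).1)) (-1) ^+ c : algC).
  rewrite [RHS]big_mkcond [LHS]big_mkcond; apply: eq_bigr => c _; rewrite in_setI.
  by case: (c \in line_stab A (fun a => (u a).2)) => //=; case: (c \in _); rewrite ?mul1r ?mul0r.
by rewrite sum_sign_common_stab; case: (dinjectiveb _ _).
Qed.

End Labels.

(** * The irreducible character of a diagram *)

Section ShapeIndex.

Variable n : nat.
Notation box := ('I_n * 'I_n)%type.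
Implicit Types (A : {set 'I_n}) (D E : {set box}) (t u : 'I_n -> box).
Implicit Types (s y p : 'S_n).

(** If no two points share a row of t y and a column of t, then the boxes
    ((t (y a)).1, (t a).2) again fill D, so a column permutation c sends a to the
    point in that box, and c^-1 y keeps the rows. *)
Lemma row_col_matching A D t : young D -> filling A D t ->
  [set y in SymG A | dinjectiveb (fun a => ((t (y a)).1, (t a).2)) (mem A)]
    = (col_stabiliser A t * row_stabiliser A t)%g.
Proof.
move=> yD tD; have [inj_t tA] := tD; apply/setP=> y.
apply/setIdP/mulsgP=> [[Sy /dinjectiveP inj] | [c r Cc Rr ->]].
  have tyD := filling_comp tD Sy.
  pose u a := ((t (y a)).1, (t a).2).
  have uD : filling A D u.
    split=> //; apply/eqP; rewrite eqEcard (card_filling tD) card_in_imset // leqnn andbT.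
    apply/subsetP=> _ /imsetP[a Aa ->].
    exact: (row_column_mem yD tyD tD inj (erefl D)).
  have [c Sc cu] := filling_perm tD uD.
  have Cc : c \in col_stabiliser A t.
    by rewrite line_stab_Sym //; apply/forall_inP=> a Aa; rewrite cu.
  exists c (c^-1 * y)%g; rewrite ?mulKVg // line_stab_Sym ?groupM ?groupV //.
  apply/forall_inP=> b Ab; rewrite permM; set a := (c^-1)%g b.
  have Aa : a \in A by rewrite Sym_closed ?groupV.
  by rewrite -[b in X in _ == X](permKV c) -/a cu.
have [Sc cc] := line_stabP _ _ _ Cc; have [Sr rr] := line_stabP _ _ _ Rr.
split; first exact: groupM.
apply/dinjectiveP=> a b Aa Ab; rewrite !permM !rr -(cc a) -(cc b) -!surjective_pairing.
by move/inj_t; rewrite !(Sym_closed _ Sc) => /(_ Aa Ab) /perm_inj.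
Qed.

Lemma card_row_col_matching A D t : young D -> filling A D t ->
  #|[set y in SymG A | dinjectiveb (fun a => ((t (y a)).1, (t a).2)) (mem A)]|
    = (#|col_stabiliser A t| * #|row_stabiliser A t|)%N.
Proof.
move=> yD tD; rewrite (row_col_matching yD tD) TI_cardMg //.
have [inj_t _] := tD.
apply/trivgP/subsetP=> c; rewrite in_setI => /andP[/line_stabP[Sc cc] /line_stabP[_ rc]].
apply/set1P; apply: (Sym_eq1 Sc) => a Aa; apply: inj_t; rewrite ?(Sym_closed _ Sc) //.
by rewrite [LHS]surjective_pairing cc rc -surjective_pairing.
Qed.

Lemma sum_row_col_mult_self A D t : young D -> filling A D t ->
  \sum_(i : Iirr (SymG A)) row_mult t 'chi_i * col_mult t 'chi_i = 1.
Proof.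
move=> yD tD; rewrite sum_row_col_mult (card_row_col_matching yD tD) natrM mulrC.
by rewrite mulrA mulfK ?neq0CG // mulfV ?neq0CG.
Qed.

Definition labelled A t (i : Iirr (SymG A)) :=
  (row_mult t 'chi_i != 0) && (col_mult t 'chi_i != 0).

(** A sum of products of natural numbers that equals 1 has one nonzero term, and
    both of its factors are 1. *)
Lemma labelled_unique A D t : young D -> filling A D t ->
  exists i : Iirr (SymG A),
    [/\ row_mult t 'chi_i = 1, col_mult t 'chi_i = 1 & forall j, labelled t j = (j == i)].
Proof.
move=> yD tD.
have Nm (i : Iirr (SymG A)) : xpredT i -> row_mult t 'chi_i * col_mult t 'chi_i \is a Num.nat.
  by move=> _; rewrite rpredM ?row_mult_nat ?col_mult_nat.
have [i [_ mi1 mj0]] := natr_sum_eq1 Nm (sum_row_col_mult_self yD tD).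
have [a ra] := natrP (row_mult_nat t i); have [b cb] := natrP (col_mult_nat t i).
have /eqP : (a * b)%N = 1%N by apply/eqP; rewrite -(eqr_nat algC) natrM -ra -cb mi1.
rewrite muln_eq1 => /andP[/eqP a1 /eqP b1].
exists i; split; rewrite ?ra ?cb ?a1 ?b1 // => j; apply/idP/eqP=> [|->].
  by apply: contraTeq => /mj0/(_ isT)/eqP; rewrite mulf_eq0 /labelled -negb_or => ->.
by rewrite /labelled ra cb a1 b1 oner_eq0.
Qed.

(** A common label makes both cross sums nonzero, so each diagram is dominated by
    the other. *)
Lemma labelled_inj A D E t u (i : Iirr (SymG A)) : young D -> young E ->
  filling A D t -> filling A E u -> labelled t i -> labelled u i -> D = E.
Proof.
have le D1 E1 t1 u1 : young E1 -> filling A D1 t1 -> filling A E1 u1 ->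
    labelled t1 i -> labelled u1 i -> forall k, (rows_below D1 k <= rows_below E1 k)%N.
  move=> yE tD uE /andP[ti _] /andP[_ ui] k.
  have [y] : exists y, y \in
      [set y in SymG A | dinjectiveb (fun a => ((t1 (y a)).1, (u1 a).2)) (mem A)].
    apply/set0Pn; apply: contra_neq ti => H.
    apply: (mulIf ui); rewrite mul0r; apply/eqP.
    have := sum_row_col_mult A t1 u1; rewrite H cards0 mulr0 => /eqP.
    rewrite psumr_eq0 => [/allP/(_ i (mem_index_enum i)) // | j _].
    by rewrite mulr_ge0 ?natr_ge0 ?row_mult_nat ?col_mult_nat.
  case/setIdP=> Sy /dinjectiveP inj.
  exact: (rows_below_le yE (filling_comp tD Sy) uE inj).
move=> yD yE tD uE ti ui; apply: young_inj => // k.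
by apply/eqP; rewrite eqn_leq (le _ _ _ _ yE tD uE) // (le _ _ _ _ yD uE tD).
Qed.

Lemma line_stabJ A (f g : 'I_n -> 'I_n) p : p \in SymG A ->
  {in A, forall a, f (p a) = g a} -> line_stab A f = (line_stab A g :^ p)%g.
Proof.
move=> Sp fg; apply/setP=> s; rewrite mem_conjg.
have [Ss | nSs] := boolP (s \in SymG A); last first.
  have nSsp : (s ^ p^-1)%g \notin SymG A by rewrite groupJr ?groupV.
  by apply/idP/idP=> /line_stabP[Ss _]; [move: nSs | move: nSsp]; rewrite Ss.
rewrite !line_stab_Sym ?groupJ ?groupV //.
apply/forall_inP/forall_inP=> H a Aa.
  have Apa : p a \in A by rewrite Sym_closed.
  have -> : (s ^ p^-1)%g a = (p^-1)%g (s (p a)) by rewrite -{1}(permK p a) permJ.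
  by rewrite -!fg ?(Sym_closed _ Ss) ?Sym_closed ?groupV // permKV H.
have Aa' : (p^-1)%g a \in A by rewrite Sym_closed ?groupV.
have := H _ Aa'; rewrite permJ -!fg ?Sym_closed ?groupV //.
by rewrite !permKV.
Qed.

Lemma sum_conjg_cfun A (K L : {group 'S_n}) (F : 'S_n -> algC) p :
  L \subset SymG A -> p \in SymG A ->
  {in SymG A &, forall g h, F (g ^ h)%g = F g} -> K :=: (L :^ p)%g ->
  #|K|%:R^-1 * \sum_(g in K) F g = #|L|%:R^-1 * \sum_(g in L) F g.
Proof.
move=> sLS Sp FJ ->; rewrite cardJg; congr (_ * _).
rewrite (reindex_inj (conjg_inj p)) /=; apply: eq_big => [g|g]; rewrite memJ_conjg //.
by move=> Lg; rewrite FJ // (subsetP sLS).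
Qed.

Lemma mult_filling A D t u (chi : 'CF(SymG A)) : filling A D t -> filling A D u ->
  row_mult t chi = row_mult u chi /\ col_mult t chi = col_mult u chi.
Proof.
move=> tD uD; have [p Sp pE] := filling_perm tD uD.
rewrite !row_multE !col_multE; split.
  apply: (sum_conjg_cfun (line_stab_sub _ _) Sp) => [g h Sg Sh|]; first by rewrite cfunJ.
  by apply: line_stabJ => // a Aa; rewrite pE.
apply: (sum_conjg_cfun (line_stab_sub _ _) Sp) => [g h Sg Sh|]; first by rewrite cfunJ // odd_permJ.
by apply: line_stabJ => // a Aa; rewrite pE.
Qed.

(** An arbitrary filling. The default value of nth is never reached on A when A and
    D have the same size. *)
Definition tableau A D (a : 'I_n) : box := nth (a, a) (enum D) (index a (enum A)).

Lemma filling_tableau A D : #|D| = #|A| -> filling A D (tableau A D).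
Proof.
move=> eqDA; have sz : size (enum D) = size (enum A) by rewrite -!cardE.
have inj : {in A &, injective (tableau A D)}.
  move=> a b Aa Ab; rewrite /tableau (set_nth_default (b, b)) ?sz ?index_mem ?mem_enum //.
  move/eqP; rewrite nth_uniq ?sz ?index_mem ?mem_enum ?enum_uniq // => /eqP e.
  by rewrite -(nth_index a (_ : a \in enum A)) ?mem_enum // e nth_index ?mem_enum.
split=> //; apply/eqP; rewrite eqEcard card_in_imset // eqDA leqnn andbT.
apply/subsetP=> _ /imsetP[a Aa ->]; rewrite -mem_enum mem_nth // sz index_mem mem_enum //.
Qed.

Definition shape_Iirr A D : Iirr (SymG A) :=
  odflt 0 [pick i | labelled (tableau A D) i].

Lemma shape_IirrE A D t (i : Iirr (SymG A)) : young D -> filling A D t ->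
  labelled t i = (i == shape_Iirr A D).
Proof.
move=> yD tD; have tabD := filling_tableau (card_filling tD).
have -> : labelled t i = labelled (tableau A D) i.
  by rewrite /labelled; have [-> ->] := mult_filling 'chi_i tD tabD.
have [j [_ _ lab]] := labelled_unique yD tabD.
rewrite lab /shape_Iirr; case: pickP => [k | /(_ j)]; rewrite lab ?eqxx //.
by move/eqP->.
Qed.

Lemma shape_Iirr_mult A D t : young D -> filling A D t ->
  row_mult t 'chi_(shape_Iirr A D) = 1 /\ col_mult t 'chi_(shape_Iirr A D) = 1.
Proof.
move=> yD tD; have [i [r1 c1 lab]] := labelled_unique yD tD.
suff <- : i = shape_Iirr A D by [].
by apply/eqP; rewrite -(shape_IirrE _ yD tD) lab.
Qed.

Lemma shape_Iirr_inj A D E : young D -> young E -> #|D| = #|A| -> #|E| = #|A| ->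
  shape_Iirr A D = shape_Iirr A E -> D = E.
Proof.
move=> yD yE cD cE eqDE; have tD := filling_tableau cD; have tE := filling_tableau cE.
apply: (labelled_inj (i := shape_Iirr A D) yD yE tD tE).
  by rewrite (shape_IirrE _ yD tD).
by rewrite (shape_IirrE _ yE tE) eqDE.
Qed.

Definition flip (b : box) : box := (b.2, b.1).

Lemma flipK : involutive flip. Proof. by case. Qed.

Lemma young_flip D : young D -> young (flip @: D).
Proof.
move/youngP=> yD; apply/youngP=> _ c /imsetP[b Db ->] le1 le2.
by rewrite -[c]flipK imset_f // (yD b).
Qed.

Lemma filling_flip A D t : filling A D t -> filling A (flip @: D) (fun a => flip (t a)).
Proof.
move=> [inj_t <-]; split=> [a b Aa Ab /(can_inj flipK)|]; first exact: inj_t.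
by rewrite -imset_comp.
Qed.

(** Flipping a filling exchanges rows and columns, and multiplication by the sign
    exchanges the two multiplicities. *)
Lemma sign_shape A D : young D -> #|D| = #|A| ->
  sign_cfun (SymG A) * 'chi_(shape_Iirr A D) = 'chi_(shape_Iirr A (flip @: D)).
Proof.
move=> yD cD; have tD := filling_tableau cD.
have /irrP[i Ei] : sign_cfun (SymG A) * 'chi_(shape_Iirr A D) \in irr (SymG A).
  by rewrite mul_lin_irr ?sign_cfun_lin ?mem_irr.
rewrite Ei; congr 'chi_ _; apply/eqP.
rewrite -(shape_IirrE _ (young_flip yD) (filling_flip tD)) /labelled -Ei.
have [r1 c1] := shape_Iirr_mult yD tD.
suff [-> ->] : row_mult (fun a => flip (tableau A D a)) (sign_cfun (SymG A) * 'chi_(shape_Iirr A D))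
   = col_mult (tableau A D) 'chi_(shape_Iirr A D) /\
  col_mult (fun a => flip (tableau A D a)) (sign_cfun (SymG A) * 'chi_(shape_Iirr A D))
   = row_mult (tableau A D) 'chi_(shape_Iirr A D) by rewrite r1 c1 oner_eq0.
rewrite !row_multE !col_multE; split; congr (_ * _); apply: eq_bigr => g /line_stabP[Sg _].
  by rewrite cfunE sign_cfunE.
by rewrite cfunE sign_cfunE // mulrA -signr_addb addbb mul1r.
Qed.

(** The conjugate character has the conjugate multiplicities, hence the same
    label. *)
Lemma shape_real A D g : young D -> #|D| = #|A| -> g \in SymG A ->
  'chi_(shape_Iirr A D) g^-1%g = 'chi_(shape_Iirr A D) g.
Proof.
move=> yD cD Sg; have tD := filling_tableau cD; set i := shape_Iirr A D.
have /irrP[j Ej] : ('chi_i)^*%CF \in irr (SymG A) by rewrite cfAut_irr mem_irr.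
suff e : j = i by rewrite irr_inv -[in RHS]e -Ej cfunE.
apply/eqP; rewrite -(shape_IirrE _ yD tD) /labelled -Ej.
have [r1 c1] := shape_Iirr_mult yD tD.
have [-> ->] : row_mult (tableau A D) ('chi_i)^*%CF = (row_mult (tableau A D) 'chi_i)^* /\
   col_mult (tableau A D) ('chi_i)^*%CF = (col_mult (tableau A D) 'chi_i)^*.
  rewrite !row_multE !col_multE; split; rewrite rmorphM fmorphV rmorph_nat rmorph_sum;
    congr (_ * _); apply: eq_bigr => h _; rewrite !cfunE //.
  by rewrite rmorphM rmorph_sign.
by rewrite r1 c1 conjC1 oner_eq0.
Qed.

End ShapeIndex.

(** * Young symmetrisers and the lower bound for branching *)

Section YoungSymmetriser.

Variable n : nat.
Notation box := ('I_n * 'I_n)%type.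
Implicit Types (A : {set 'I_n}) (D E : {set box}) (t u : 'I_n -> box).
Implicit Types (s y p g : 'S_n).

(** Irreducibility gives g with ER g EC nonzero. If two points share a row of t
    g^-1 and a column of t, their transposition c lies in C with g c g^-1 in R,
    which makes ER g EC equal to its opposite. So g lies in R C, and then
    ER g EC is ER EC up to sign. *)
Lemma young_symmetriser_neq0 A D t m (rG : mx_representation algC (SymG A) m) :
  young D -> filling A D t -> mx_irreducible rG ->
  row_mult t (cfRepr rG) != 0 -> col_mult t (cfRepr rG) != 0 ->
  weighted_sum (1 : 'CF(row_stabiliser A t)) rG
    *m weighted_sum (sign_cfun (col_stabiliser A t)) rG != 0.
Proof.
move=> yD tD irrG r0 c0; set ER := weighted_sum 1 rG; set EC := weighted_sum _ rG.
have sR : row_stabiliser A t \subset SymG A := line_stab_sub A _.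
have sC : col_stabiliser A t \subset SymG A := line_stab_sub A _.
have lin1 : (1 : 'CF(row_stabiliser A t)) \is a linear_char by exact: rpred1.
have lins := sign_cfun_lin (col_stabiliser A t).
have ER0 : ER != 0.
  rewrite /ER (weighted_sum_eq0 rG sR lin1); apply: contraNneq r0 => e; rewrite row_multE mulf_eq0.
  apply/orP; right; rewrite -[X in _ == X]e; apply/eqP/eq_bigr => g Rg.
  by rewrite cfun1E Rg mul1r.
have EC0 : \tr EC != 0.
  rewrite /EC (mxtrace_weighted_sum _ rG sC); apply: contraNneq c0 => e; rewrite col_multE mulf_eq0.
  apply/orP; right; rewrite -[X in _ == X]e; apply/eqP/eq_bigr => g Cg.
  by rewrite sign_cfunE.
have actR g : g \in row_stabiliser A t -> ER *m rG g = ER.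
  by move=> Rg; have [_ ->] := weighted_sum_act rG sR lin1 Rg; rewrite cfun1E groupV Rg scale1r.
have actC g : g \in col_stabiliser A t -> rG g *m EC = (-1) ^+ g *: EC.
  move=> Cg; have [-> _] := weighted_sum_act rG sC lins Cg.
  by rewrite sign_cfunE ?groupV // odd_permV.
have [g Sg] := exists_link irrG ER0 EC0; apply: contraNneq => RC0.
have RSg := groupVr Sg.
have [inj|/common_stab_tperm[c]] :=
    dinjectiveP (fun a => ((t ((g^-1)%g a)).1, (t a).2)) (mem A).
  have : (g^-1)%g \in (col_stabiliser A t * row_stabiliser A t)%g.
    by rewrite -(row_col_matching yD tD); apply/setIdP; split=> //; apply/dinjectiveP.
  case/mulsgP=> c r Cc Rr /(canRL invgK) ->.
  have [Sc Sr] : c \in SymG A /\ r \in SymG A by rewrite (subsetP sC) ?(subsetP sR).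
  rewrite invMg repr_mxM ?groupV // mulmxA actR ?groupV //.
  by rewrite -mulmxA actC ?groupV // -scalemxAr RC0 scaler0.
rewrite in_setI => /andP[Cc /line_stabP[Sc fc]] odd_c.
have Rcg : (c ^ g^-1)%g \in row_stabiliser A t.
  apply/line_stabP; split=> [|k]; first by rewrite groupJ.
  by rewrite -{1}(permK g k) permJ fc permK.
have X0 : ER *m rG g *m EC = - (ER *m rG g *m EC).
  rewrite -{1}(actR _ Rcg) -!mulmxA [rG _ *m (rG g *m _)]mulmxA -repr_mxM ?groupJ //.
  rewrite (_ : (c ^ g^-1 * g)%g = (g * c)%g); last by rewrite conjgE invgK -!mulgA mulVg mulg1.
  by rewrite repr_mxM // -mulmxA actC // odd_c scaleN1r !mulmxN.
by move/eqP: X0; rewrite -addr_eq0 -mulr2n -scaler_nat scaler_eq0 pnatr_eq0.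
Qed.

(** The product of the two sums as a single element of the group ring, the form
    needed to find a constituent on which it does not vanish. *)
Lemma ring_image_weighted_sum_mul (gT : finGroupType) (H K L : {group gT})
    (sKH : K \subset H) (sLH : L \subset H) (s : 'CF(K)) (r : 'CF(L))
    m (rH : mx_representation algC H m) :
  ring_image (fun h => \sum_(k in K) \sum_(l in L) s k * r l * (h == k * l)%g%:R) rH
    = weighted_sum s rH *m weighted_sum r rH.
Proof.
rewrite /ring_image /weighted_sum mulmx_suml.
under eq_bigr do rewrite scaler_suml.
rewrite exchange_big; apply: eq_bigr => k Kk; rewrite mulmx_sumr.
under eq_bigr do rewrite scaler_suml.
rewrite exchange_big; apply: eq_bigr => l Ll.
have [Hk Hl] : k \in H /\ l \in H by split; [apply: (subsetP sKH) | apply: (subsetP sLH)].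
have Hkl : (k * l)%g \in H by apply: groupM.
rewrite (bigD1 (k * l)%g) //= eqxx mulr1 big1 ?addr0 => [|h /andP[_ /negPf->]].
  by rewrite repr_mxM // -scalemxAl -scalemxAr scalerA.
by rewrite mulr0 scale0r.
Qed.

Lemma line_stabS (A B : {set 'I_n}) (f : 'I_n -> 'I_n) :
  A \subset B -> line_stab A f \subset line_stab B f.
Proof.
move=> sAB; apply/subsetP=> s /line_stabP[Ss fs]; apply/line_stabP; split=> //.
exact: subsetP (Sym_sub sAB) _ Ss.
Qed.

(** Take a filling with a in the box b. The row and column groups R' and C' of A
    minus a are subgroups of R and C, so ER EC = ER (ER' EC') EC up to a nonzero
    factor and ER' EC' does not vanish on the restriction. A constituent on which
    it does not vanish has label D minus b. *)
Lemma branching_neq0 A D a b : young D -> #|D| = #|A| -> a \in A ->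
    b \in D -> young (D :\ b) ->
  '['Res[SymG (A :\ a)] 'chi_(shape_Iirr A D), 'chi_(shape_Iirr (A :\ a) (D :\ b))] != 0.
Proof.
move=> yD cD Aa Db yDb.
have [t tD tab] : exists2 t, filling A D t & t a = b.
  have tabD := filling_tableau cD; have [_ tA] := tabD.
  move: Db; rewrite -tA => /imsetP[c Ac ->]; exists (fun x => tableau A D (tperm a c x)).
    by rewrite tA; apply: filling_comp tabD (tperm_Sym Aa Ac).
  by rewrite tpermL.
have sAa := subD1set A a; have sHG := Sym_sub sAa.
have tDb : filling (A :\ a) (D :\ b) t.
  have [inj_t tA] := tD; split=> [x y | ].
    by move=> /setD1P[_ Ax] /setD1P[_ Ay]; apply: inj_t.
  apply/setP=> c; apply/imsetP/setD1P=> [[x /setD1P[xa Ax] ->] | [cb]].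
    split; last by rewrite -tA imset_f.
    by apply: contraNneq xa; rewrite -tab => /inj_t->.
  rewrite -tA => /imsetP[x Ax e]; exists x => //; apply/setD1P; split=> //.
  by apply: contra_neq cb => xa; rewrite e xa tab.
set i := shape_Iirr A D.
have /irr_reprP[rG irrG chiE] := mem_irr i.
have [r1 c1] := shape_Iirr_mult yD tD.
have sR : row_stabiliser A t \subset SymG A := line_stab_sub A _.
have sC : col_stabiliser A t \subset SymG A := line_stab_sub A _.
have sR' : row_stabiliser (A :\ a) t \subset SymG (A :\ a) := line_stab_sub _ _.
have sC' : col_stabiliser (A :\ a) t \subset SymG (A :\ a) := line_stab_sub _ _.
have sRR : row_stabiliser (A :\ a) t \subset row_stabiliser A t := line_stabS _ sAa.
have sCC : col_stabiliser (A :\ a) t \subset col_stabiliser A t := line_stabS _ sAa.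
have lin1 : (1 : 'CF(row_stabiliser A t)) \is a linear_char by exact: rpred1.
have lins := sign_cfun_lin (col_stabiliser A t).
have lin1' : (1 : 'CF(row_stabiliser (A :\ a) t)) \is a linear_char by exact: rpred1.
have lins' := sign_cfun_lin (col_stabiliser (A :\ a) t).
have := young_symmetriser_neq0 yD tD irrG.
rewrite -chiE r1 c1 oner_eq0 => /(_ isT isT).
pose rH := subg_repr rG sHG.
pose Y := weighted_sum (1 : 'CF(row_stabiliser (A :\ a) t)) rH
  *m weighted_sum (sign_cfun (col_stabiliser (A :\ a) t)) rH.
have XE : weighted_sum (1 : 'CF(row_stabiliser A t)) rG
     *m weighted_sum (sign_cfun (col_stabiliser A t)) rG
   = #|row_stabiliser (A :\ a) t|%:R^-1 * #|col_stabiliser (A :\ a) t|%:R^-1 *: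
     (weighted_sum (1 : 'CF(row_stabiliser A t)) rG *m Y
      *m weighted_sum (sign_cfun (col_stabiliser A t)) rG).
  have [|_ e1] := weighted_sum_mul rG sR lin1 (t := (1 : 'CF(row_stabiliser (A :\ a) t))) sRR.
    by move=> g Rg; rewrite !cfun1E Rg (subsetP sRR).
  have [|e2 _] := weighted_sum_mul rG sC lins (t := sign_cfun (col_stabiliser (A :\ a) t)) sCC.
    by move=> g Rg; rewrite !sign_cfunE // (subsetP sCC).
  rewrite /Y; have -> : weighted_sum (1 : 'CF(row_stabiliser (A :\ a) t)) rH
    = weighted_sum (1 : 'CF(row_stabiliser (A :\ a) t)) rG by [].
  have -> : weighted_sum (sign_cfun (col_stabiliser (A :\ a) t)) rH
    = weighted_sum (sign_cfun (col_stabiliser (A :\ a) t)) rG by [].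
  rewrite mulmxA -mulmxA e2 e1 -scalemxAl -scalemxAr !scalerA.
  by rewrite [_ / _ * _]mulrAC mulVf ?neq0CG // mul1r mulVf ?neq0CG // scale1r.
rewrite {}XE scaler_eq0 negb_or => /andP[_].
have [-> | Y0 _] := eqVneq Y 0.
  by rewrite mulmx0 mul0mx eqxx.
move: Y0; rewrite /Y -ring_image_weighted_sum_mul // => /ring_image_constituent[j jres].
rewrite ring_image_weighted_sum_mul // => W0.
have -> : 'chi_i = cfRepr rG by [].
rewrite -(cfRepr_sub rG sHG).
suff <- : j = shape_Iirr (A :\ a) (D :\ b) by rewrite -irr_consttE.
apply/eqP; rewrite -(shape_IirrE _ yDb tDb) /labelled.
apply/andP; split.
  apply: contraNneq W0; rewrite row_multE => /eqP.
  rewrite mulf_eq0 invr_eq0 (negPf (neq0CG _)) /= => e.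
  apply/eqP; suff /eqP-> : weighted_sum (1 : 'CF(row_stabiliser (A :\ a) t)) 'Chi_j == 0.
    by rewrite mul0mx.
  rewrite weighted_sum_eq0 // irrRepr; apply/eqP; rewrite -[RHS](eqP e); apply: eq_bigr => g Rg.
  by rewrite cfun1E Rg mul1r.
apply: contraNneq W0; rewrite col_multE => /eqP.
rewrite mulf_eq0 invr_eq0 (negPf (neq0CG _)) /= => e.
apply/eqP; suff /eqP-> : weighted_sum (sign_cfun (col_stabiliser (A :\ a) t)) 'Chi_j == 0.
  by rewrite mulmx0.
rewrite weighted_sum_eq0 // irrRepr; apply/eqP; rewrite -[RHS](eqP e); apply: eq_bigr => g Rg.
by rewrite sign_cfunE.
Qed.

End YoungSymmetriser.

(** * Corners and addable boxes *)

Section Corners.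

Variable n : nat.
Notation box := ('I_n * 'I_n)%type.
Implicit Types (A : {set 'I_n}) (D E : {set box}) (b c : box).

Definition addable D := [set c | (c \notin D) && young (c |: D)].
Definition corners D := [set b in D | young (D :\ b)].
Definition shapes k := [set D : {set box} | young D && (#|D| == k)].

Lemma shapesP k D : reflect (young D /\ #|D| = k) (D \in shapes k).
Proof. by rewrite inE; apply: (iffP andP) => -[yD /eqP]. Qed.

(** Without b the set D is still closed under going up and left, so it has no box
    below or right of b. *)
Lemma corner_max D b c : b \in corners D -> c \in D ->
  (b.1 <= c.1)%N -> (b.2 <= c.2)%N -> c = b.
Proof.
case/setIdP=> Db /youngP yDb Dc le1 le2; apply/eqP; apply: contraT => cb.
by have := yDb c b; rewrite !inE cb Dc eqxx => /(_ isT le1 le2).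
Qed.

Lemma young_cons D c : young D ->
  (forall b : box, (b.1 <= c.1)%N -> (b.2 <= c.2)%N -> b != c -> b \in D) ->
  young (c |: D).
Proof.
move=> /youngP yD below; apply/youngP=> x y /setU1P[-> | Dx] le1 le2; rewrite !inE.
  by have [//|yc] := eqVneq y c; rewrite below.
by rewrite (yD x) ?orbT.
Qed.

Lemma young_row_bound D b : young D -> b \in D -> (b.1 < #|D|)%N.
Proof.
move=> /youngP yD Db; rewrite -[X in (X <= _)%N](card_ord_lt (ltn_ord b.1)).
have inj : injective (fun i : 'I_n => (i, b.2)) by move=> i j [].
rewrite -(card_imset _ inj); apply/subset_leq_card/subsetP=> _ /imsetP[i + ->].
by rewrite inE ltnS => le_i; apply: yD Db _ _.
Qed.

(** The first free box of the next row is addable, because that row is strictly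
    shorter than the row of the corner. The bound on #|D| keeps the row inside the
    n by n frame. *)
Lemma addable_below_corner D b : young D -> (#|D| < n)%N -> b \in corners D ->
  exists2 c, c \in addable D & c.1 = b.1.+1 :> nat.
Proof.
move=> yD lt_Dn cb; have [Db yDb] := setIdP cb.
have lt1 : (b.1.+1 < n)%N by apply: leq_ltn_trans (young_row_bound yD Db) lt_Dn.
pose i := Ordinal lt1; set m := #|[set c in D | c.1 == i]|.
have le_m : (m <= b.2)%N.
  rewrite leqNgt -[b.2]/((i, b.2).2) -(young_row (i, b.2) yD).
  apply/negP=> /(corner_max cb)/(_ (leqnSn _) (leqnn _)).
  by move/(congr1 (fun x : box => val x.1))/eqP; rewrite /= gtn_eqF.
have lt_m : (m < n)%N := leq_ltn_trans le_m (ltn_ord _).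
exists (i, Ordinal lt_m) => //; rewrite inE young_row // ltnn /=.
apply: young_cons => // x le1 le2 xc.
have [e | ne] := eqVneq x.1 i.
  rewrite young_row // e -/m ltn_neqAle le2 andbT; apply: contra_neq xc => e2.
  by rewrite [LHS]surjective_pairing e; congr (_, _); apply: val_inj.
have /youngP/(_ _ x Db) := yD; apply; last exact: leq_trans le2 le_m.
by rewrite -ltnS ltn_neqAle le1 andbT.
Qed.

Lemma addable_first_row D : young D -> (#|D| < n)%N ->
  exists2 c, c \in addable D & c.1 = 0%N :> nat.
Proof.
move=> yD lt_Dn; have n0 : (0 < n)%N by apply: leq_ltn_trans lt_Dn.
pose i := Ordinal n0; set m := #|[set c in D | c.1 == i]|.
have lt_m : (m < n)%N.
  by apply: leq_ltn_trans lt_Dn; apply/subset_leq_card/subsetP=> x /setIdP[].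
exists (i, Ordinal lt_m) => //; rewrite inE young_row // ltnn /=.
apply: young_cons => // x; rewrite leqn0 => /eqP x1 le2 xc.
have e : x.1 = i by apply: val_inj.
rewrite young_row // e -/m ltn_neqAle le2 andbT; apply: contra_neq xc => e2.
by rewrite [LHS]surjective_pairing e; congr (_, _); apply: val_inj.
Qed.

Lemma corner_row_inj D : {in corners D &, injective (fun b => b.1)}.
Proof.
move=> b c cb cc /= e; have [Db _] := setIdP cb; have [Dc _] := setIdP cc.
have [le | /ltnW le] := leqP b.2 c.2.
  by apply/esym; apply: (corner_max cb) => //; rewrite e.
by apply: (corner_max cc) => //; rewrite e.
Qed.

(** Corners are determined by their rows. Each row following that of a corner has
    an addable box, and so does the first row. *)
Lemma card_corners_addable D : young D -> (#|D| < n)%N -> (#|corners D| < #|addable D|)%N.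
Proof.
move=> yD lt_Dn.
(* The next row; the default value is never taken at the row of a corner. *)
pose S (i : 'I_n) : 'I_n := insubd i i.+1.
have SE b : b \in corners D -> S b.1 = b.1.+1 :> nat.
  move=> cb; have [c _ e] := addable_below_corner yD lt_Dn cb.
  by rewrite val_insubd -e ltn_ord.
have [c0 ac0 c00] := addable_first_row yD lt_Dn.
have <- : #|[set S b.1 | b in corners D]| = #|corners D|.
  apply: card_in_imset => b c cb cc /(congr1 val) /=.
  by rewrite !SE // => -[/val_inj e]; apply: (corner_row_inj cb cc e).
apply: (@leq_trans #|c0.1 |: [set S b.1 | b in corners D]|).
  rewrite cardsU1 [X in (~~ X + _)%N](_ : _ = false) //.
  by apply/negP=> /imsetP[b cb /(congr1 val)/=]; rewrite c00 SE.
apply: leq_trans (leq_imset_card (fun c => c.1) (mem (addable D))).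
apply/subset_leq_card/subsetP=> i /setU1P[-> | /imsetP[b cb ->]].
  by apply: imset_f.
have [c ac e] := addable_below_corner yD lt_Dn cb.
by apply/imsetP; exists c => //; apply: val_inj; rewrite /= e SE.
Qed.

Lemma subshapesE D k : young D -> #|D| = k.+1 ->
  [set E in shapes k | E \subset D] = [set D :\ b | b in corners D].
Proof.
move=> yD cD; apply/setP=> E.
apply/setIdP/imsetP=> [[/shapesP[yE cE] sED] | [b /setIdP[Db yDb] ->]].
  have /cards1P[b Eb] : #|D :\: E| == 1%N by rewrite cardsDS // cD cE subSnn.
  have DbE : D :\ b = E by rewrite -Eb setDDr setDv set0U; apply/setIidPr.
  have /setDP[Db _] : b \in D :\: E by rewrite Eb set11.
  by exists b => //; apply/setIdP; rewrite DbE.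
split; last exact: subD1set.
by apply/shapesP; split=> //; apply/eqP; rewrite -eqSS -cD (cardsD1 b D) Db.
Qed.

Lemma card_subshapes D k : young D -> #|D| = k.+1 ->
  #|[set E in shapes k | E \subset D]| = #|corners D|.
Proof.
move=> yD cD; rewrite subshapesE // card_in_imset // => b c /setIdP[Db _] /setIdP[Dc _] e.
apply/eqP; rewrite -in_set1; apply/negPn/negP=> cb.
have : b \in D :\ c by rewrite in_setD1 Db andbT -in_set1.
by rewrite -e setD11.
Qed.

Lemma supershape_addable D E : young E -> D \subset E -> #|E| = #|D|.+1 ->
  exists2 c, c \in addable D & E = c |: D.
Proof.
move=> yE sDE cE; have /cards1P[c Ec] : #|E :\: D| == 1%N by rewrite cardsDS // cE subSnn.
have cED : c |: D = E by rewrite -Ec setUC -[RHS](setID E D) (setIidPr sDE).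
exists c => //; rewrite inE cED yE andbT.
have: c \in E :\: D by rewrite Ec set11.
by case/setDP.
Qed.

End Corners.

(** * The branching rule *)

Section Branching.

Variable n : nat.
Notation box := ('I_n * 'I_n)%type.
Implicit Types (A : {set 'I_n}) (D E : {set box}) (a b : 'I_n) (c : box).

Definition all_shaped A := forall i : Iirr (SymG A),
  exists2 D, D \in shapes n #|A| & i = shape_Iirr A D.

Definition branching_rule A := forall a D E,
  a \in A -> D \in shapes n #|A| -> E \in shapes n #|A :\ a| ->
  '['Res[SymG (A :\ a)] 'chi_(shape_Iirr A D), 'chi_(shape_Iirr (A :\ a) E)]
    = (E \subset D)%:R.

Lemma shape_Iirr_injin A : {in shapes n #|A| &, injective (shape_Iirr A)}.
Proof. by move=> D E /shapesP[yD cD] /shapesP[yE cE]; apply: shape_Iirr_inj. Qed.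

Lemma big_shapes A (F : Iirr (SymG A) -> algC) : all_shaped A ->
  \sum_i F i = \sum_(D in shapes n #|A|) F (shape_Iirr A D).
Proof.
move=> shA; rewrite -(big_imset _ (@shape_Iirr_injin A)) /=.
by apply: eq_bigl => i; have [D sD ->] := shA i; rewrite imset_f.
Qed.

(** The restriction is a multiplicity-free sum over the diagrams with one box
    fewer, which are obtained by deleting a corner. *)
Lemma cfnorm_Res_shape A a D : a \in A -> all_shaped (A :\ a) -> branching_rule A ->
  D \in shapes n #|A| ->
  '['Res[SymG (A :\ a)] 'chi_(shape_Iirr A D)] = #|corners D|%:R.
Proof.
move=> Aa shB br sD; have [yD cD] := shapesP _ _ sD.
rewrite cfdot_sum_irr big_shapes // (eq_bigr (fun E : {set box} => (E \subset D)%:R)); last first.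
  by move=> E sE; rewrite br // conjC_nat -natrM mulnb andbb.
rewrite -(card_subshapes yD (k := #|A :\ a|)); last by rewrite cD (cardsD1 a A) Aa.
by rewrite natr_card_setId.
Qed.

(** Each addable box gives a constituent, so the norm of the induced character is
    at least the number of addable boxes. It is 1 plus the number of corners, which
    is at most that number, so all multiplicities are forced. *)
Lemma Ind_shape A a E (i : Iirr (SymG A)) : a \in A -> E \in shapes n #|A :\ a| ->
  '['chi_(shape_Iirr (A :\ a) E), 'chi_(shape_Iirr (A :\ a) E) * fixed_cfun (A :\ a)]
     = #|corners E|%:R ->
  '['Ind[SymG A] 'chi_(shape_Iirr (A :\ a) E), 'chi_i]
     = (i \in [set shape_Iirr A (c |: E) | c in addable E])%:R.
Proof.
move=> Aa sE fixE; have [yE cE] := shapesP _ _ sE.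
set X := 'Ind _; set I := [set _ | _ in _].
have cA : #|A| = #|E|.+1 by rewrite cE (cardsD1 a A) Aa.
have lt_En : (#|E| < n)%N by rewrite -cA -[X in (_ <= X)%N]card_ord max_card.
have addP c : c \in addable E -> young (c |: E) /\ #|c |: E| = #|A|.
  by case/setIdP=> Ec yc; rewrite cardsU1 Ec cA.
have cI : #|I| = #|addable E|.
  apply: card_in_imset => c d ac ad /=.
  have [[yc cc] [yd cd]] := (addP c ac, addP d ad).
  move/(shape_Iirr_inj yc yd cc cd) => e.
  have [Ec _] := setIdP ac; have: c \in d |: E by rewrite -e setU11.
  by rewrite in_setU1 (negPf Ec) orbF => /eqP.
have Xchar : X \is a character by rewrite cfInd_char ?irr_char.
pose N j := Num.truncn '[X, 'chi_j].
have NE j : '[X, 'chi_j] = (N j)%:R.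
  by rewrite truncnK ?Cnat_cfdot_char ?irr_char.
have NI j : j \in I -> (0 < N j)%N.
  case/imsetP=> c ac ->; have [yc cc] := addP c ac; have [Ec _] := setIdP ac.
  rewrite -(ltr_nat algC) -NE lt_def natr_ge0 ?Cnat_cfdot_char ?irr_char // andbT.
  rewrite -Frobenius_reciprocity cfdotC_char ?cfRes_char ?irr_char //.
  have := branching_neq0 yc cc Aa (setU11 c E).
  by rewrite (setU1K Ec) => /(_ yE).
(* The norm is 1 plus the number of corners of E; #|I| is larger than the latter. *)
have sumN : (\sum_j N j ^ 2 <= \sum_j (j \in I))%N.
  rewrite -(ler_nat algC) natr_sum.
  rewrite (eq_bigr (fun j => '[X, 'chi_j] * ('[X, 'chi_j])^*)); last first.
    by move=> j _; rewrite NE conjC_nat -natrM.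
  rewrite -cfdot_sum_irr cfnorm_Ind_point_stabiliser // fixE cfnorm_irr.
  have -> : (\sum_j (j \in I) = #|addable E|)%N.
    by rewrite -cI -sum1_card [RHS]big_mkcond; apply: eq_bigr => j _; case: (j \in I).
  by rewrite addrC natr1 ler_nat; apply: card_corners_addable.
have le1 j : ((j \in I) <= N j ^ 2 ?= iff ((j \in I) == N j ^ 2 :> nat))%N.
  apply: leqif_eq; case Ij: (j \in I) => //.
  by rewrite expn_gt0 NI.
have := leqif_sum (fun j (_ : true) => le1 j).
move=> [le] /esym; rewrite eqn_leq le sumN => /forall_inP/(_ i isT)/eqP Ni.
rewrite NE Ni; case: (i \in I) Ni => /= /esym/eqP; last by rewrite expn_eq0 => /andP[/eqP->].
by rewrite -[1%N]/(1 ^ 2)%N eqn_exp2r // => /eqP->.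
Qed.

Lemma branching_from_norm A : A != set0 ->
  (forall a, a \in A -> all_shaped (A :\ a)) ->
  (forall a E, a \in A -> E \in shapes n #|A :\ a| ->
    '['chi_(shape_Iirr (A :\ a) E), 'chi_(shape_Iirr (A :\ a) E) * fixed_cfun (A :\ a)]
     = #|corners E|%:R) ->
  all_shaped A /\ branching_rule A.
Proof.
move=> /set0Pn[a0 Aa0] shA nA.
have addP a E c : a \in A -> E \in shapes n #|A :\ a| -> c \in addable E ->
    c |: E \in shapes n #|A|.
  move=> Aa /shapesP[yE cE] /setIdP[Ec yc]; apply/shapesP; split=> //.
  by rewrite cardsU1 Ec cE [RHS](cardsD1 a A) Aa.
split=> [i | a D E Aa sD sE].
  have [j] := constt_cfRes_irr (SymG (A :\ a0)) i.
  have [E sE ->] := shA a0 Aa0 j.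
  rewrite irr_consttE cfdot_Res_l cfdotC_char ?cfInd_char ?irr_char //.
  rewrite Ind_shape ?nA //; case: imsetP => [[c ac ->] _ | _]; last by rewrite eqxx.
  by exists (c |: E) => //; apply: addP Aa0 sE ac.
rewrite cfdot_Res_l cfdotC_char ?cfInd_char ?irr_char // Ind_shape ?nA //.
congr (nat_of_bool _)%:R; apply/imsetP/idP=> [[c ac] | sED].
  by move/(shape_Iirr_injin sD (addP _ _ _ Aa sE ac)) => ->; rewrite subsetU1.
have [yD cD] := shapesP _ _ sD; have [yE cE] := shapesP _ _ sE.
have [|c ac ->] := supershape_addable yD sED; first by rewrite cD cE (cardsD1 a A) Aa.
by exists c.
Qed.

Lemma shape_Iirr_set0 : all_shaped (set0 : {set 'I_n}).
Proof.
move=> i; exists set0.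
  by apply/shapesP; split; rewrite ?cards0 //; apply/youngP=> b c; rewrite inE.
have y0 : young (set0 : {set box}) by apply/youngP=> b c; rewrite inE.
have t0 : filling (set0 : {set 'I_n}) set0 (fun a : 'I_n => (a, a)).
  by split=> [a b|]; rewrite ?inE // imset0.
apply/eqP; rewrite -(shape_IirrE _ y0 t0) /labelled.
have S1 (K : {group 'S_n}) : K \subset SymG (set0 : {set 'I_n}) -> K = [1 'S_n]%G.
  move=> sK; apply/trivGP/(subset_trans sK)/subsetP=> s Ss.
  by apply/set1P/(Sym_eq1 Ss) => a; rewrite inE.
rewrite row_multE col_multE.
rewrite (S1 (row_stabiliser _ _) (line_stab_sub _ _)) (S1 (col_stabiliser _ _) (line_stab_sub _ _)).
by rewrite !big_set1 cards1 odd_perm1 invr1 !mul1r irr1_neq0.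
Qed.

(** Induction on #|A|. The norm needed for A minus a is, by reciprocity, the norm of
    a restriction to the stabiliser of a second point, known by induction. *)
Theorem branching A : all_shaped A /\ branching_rule A.
Proof.
have [k] := ubnP #|A|; elim: k A => // k IH A le_Ak.
have [-> | A0] := eqVneq A set0.
  by split=> [|a D E]; [exact: shape_Iirr_set0 | rewrite inE].
have ltA a : a \in A -> (#|A :\ a| < k)%N.
  by move=> Aa; move: le_Ak; rewrite (cardsD1 a A) Aa.
apply: branching_from_norm => // [a Aa | a E Aa sE].
  by have [] := IH _ (ltA a Aa).
have [yE cE] := shapesP _ _ sE.
have [B0 | [b Bb]] := set_0Vmem (A :\ a).
  have E0 : E = set0 by apply/eqP; rewrite -cards_eq0 cE B0 cards0.
  have -> : fixed_cfun (A :\ a) = 0.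
    apply/cfun_inP=> s Ss; rewrite fixed_cfunE // num_fixedE B0 big_set0 cfunE //.
  rewrite mulr0 cfdot0r; suff -> : corners E = set0 by rewrite cards0.
  by apply/setP=> c; rewrite !inE E0 inE.
have [_ brB] := IH _ (ltA a Aa).
have [shC _] : all_shaped (A :\ a :\ b) /\ branching_rule (A :\ a :\ b).
  apply: IH; apply: leq_trans (ltA a Aa); rewrite ltnS.
  by apply/subset_leq_card/subD1set.
rewrite cfdotC (cfdot_fixed _ _ Bb) -cfdotC.
exact: cfnorm_Res_shape.
Qed.

End Branching.

(** * The sign-twisted indicator of a diagram *)

(** Removing one 2-cycle changes the sign and lowers the number of moved points by
    2. *)
Lemma involution_sign (T : finType) (s : {perm T}) : (s * s = 1)%g ->
  odd_perm s = odd (#|[set a | s a != a]| %/ 2) /\ ~~ odd #|[set a | s a != a]|.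
Proof.
have [k] := ubnP #|[set a | s a != a]|; elim: k s => // k IH s le_k ss.
have sK a : s (s a) = a by rewrite -permM ss perm1.
have [M0 | [a]] := set_0Vmem [set a | s a != a].
  suff -> : s = 1%g.
    rewrite odd_perm1 (_ : [set a | _] = set0) ?cards0 //.
    by apply/setP=> a; rewrite !inE perm1 eqxx.
  apply/permP=> a; rewrite perm1; apply/eqP.
  by move/setP/(_ a): M0; rewrite !inE => /negbFE.
rewrite inE => sa; pose s' := (tperm a (s a) * s)%g.
have s'E x : s' x = if (x == a) || (x == s a) then x else s x.
  rewrite permM; case: tpermP => [->|->|/eqP/negPf-> /eqP/negPf-> //]; rewrite ?eqxx ?orbT ?sK //.
have ss' : (s' * s' = 1)%g.
  apply/permP=> x; rewrite permM perm1 !s'E.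
  case E: ((x == a) || (x == s a)); first by rewrite E.
  have -> : (s x == a) || (s x == s a) = false.
    by rewrite (inj_eq perm_inj) (can2_eq sK sK) orbC.
  by rewrite sK.
have [aM saM] : a \in [set a | s a != a] /\ s a \in [set a | s a != a] :\ a.
  by rewrite !inE sa sK eq_sym.
have M' : [set a | s' a != a] = [set a | s a != a] :\ a :\ s a.
  apply/setP=> x; rewrite !inE s'E.
  by case: (x == a); case: (x == s a); rewrite /= ?eqxx ?andbF.
have cM : #|[set a | s a != a]| = #|[set a | s' a != a]|.+2.
  by rewrite M' (cardsD1 a) aM (cardsD1 (s a)) saM.
have [|e1 e2] := IH s' _ ss'; first by rewrite -ltnS -cM; apply: leq_trans le_k; rewrite cM.
rewrite cM /= negbK e2; split=> //.
rewrite -addn2 divnDr // oddD addbT -e1 odd_permM odd_tperm eq_sym sa.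
by rewrite addTb negbK.
Qed.

Section TwistedIndicator.

Variable n : nat.
Notation box := ('I_n * 'I_n)%type.
Implicit Types (A : {set 'I_n}) (D E : {set box}).

Definition diagonal D := [set b in D | b.1 == b.2].

(** The permutation that reflects the tableau in the diagonal. It moves the points
    off the diagonal, which have an even number. *)
Lemma filling_transpose A D t : filling A D t -> (@flip n) @: D = D ->
  exists2 s, s \in SymG A & [/\ {in A, forall a, t (s a) = flip (t a)},
    (s * s = 1)%g, odd_perm s = odd ((#|A| - #|diagonal D|) %/ 2)
    & ~~ odd (#|A| - #|diagonal D|)].
Proof.
move=> tD fD; have := filling_flip tD; rewrite fD => /(filling_perm tD)[s Ss sE].
exists s => //; have [inj_t tA] := tD.
have ss : (s * s = 1)%g.
  apply: (Sym_eq1 (A := A)); first by rewrite groupM.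
  move=> a Aa; rewrite permM; apply: inj_t; rewrite ?Sym_closed //.
  by rewrite !sE ?Sym_closed // flipK.
suff <- : #|[set a | s a != a]| = (#|A| - #|diagonal D|)%N by have [] := involution_sign ss.
rewrite -(card_filling_pred (fun b => b.1 == b.2) tD) -cardsDS; last first.
  by apply/subsetP=> a /setIdP[].
apply: eq_card => a; rewrite inE in_setD in_set.
have [Aa | A'a] := boolP (a \in A); last by rewrite (Sym_out Ss A'a) eqxx.
rewrite andbT /=; congr (~~ _); apply/eqP/eqP=> [e | e].
  by have := sE a Aa; rewrite e => /(congr1 fst).
apply: inj_t; rewrite ?Sym_closed // sE // /flip [RHS]surjective_pairing.
by rewrite e.
Qed.

Definition sign_indicator A (chi : 'CF(SymG A)) :=
  #|SymG A|%:R^-1 * \sum_(g in SymG A) (-1) ^+ g * chi (g * g)%g.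

Lemma sign_indicator_sum A (chi : 'CF(SymG A)) (c : algC) :
  \sum_(g in SymG A) sign_cfun (SymG A) g * chi (g * g)%g = #|SymG A|%:R * c ->
  sign_indicator chi = c.
Proof.
move=> e; apply: (canLR (mulKf (neq0CG _))); rewrite -e.
by apply: eq_bigr => g Sg; rewrite sign_cfunE.
Qed.

(** When D is symmetric, M is the Young symmetriser of a filling t followed by the
    reflection s of t. Conjugation by s exchanges R and C, so the inverse of r c s
    is r' c' s with r' in R and c' in C; this is where M is multiplied by the sign
    of s. The rank is 1 because the row multiplicity is 1. *)
Lemma sign_indicator_shape A D : D \in shapes n #|A| ->
  sign_indicator 'chi_(shape_Iirr A D)
    = if (@flip n) @: D == D then (-1) ^+ ((#|A| - #|diagonal D|) %/ 2) else 0.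
Proof.
case/shapesP=> yD cD; set i := shape_Iirr A D; apply: sign_indicator_sum.
have /irr_reprP[rG irrG chiE] := mem_irr i.
have lin_s := sign_cfun_lin (SymG A); have s_sq := @sign_cfun_sq n (SymG A).
have chi_real g : g \in SymG A -> cfRepr rG g^-1%g = cfRepr rG g.
  by rewrite -chiE; apply: shape_real.
have sgn_chi := sign_shape yD cD; rewrite -/i in sgn_chi.
have [fD | fD] := eqVneq; last first.
  rewrite mulr0 chiE; apply: (twisted_indicator0 irrG) => //.
  rewrite -chiE sgn_chi cfdot_irr; case: eqP => // e; case/eqP: fD.
  apply: shape_Iirr_inj e; rewrite ?young_flip ?card_imset //.
  exact: can_inj (@flipK n).
have [t tD] : exists t, filling A D t by exists (tableau A D); apply: filling_tableau.
have [s Ss [sE ss os _]] := filling_transpose tD fD.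
rewrite -[in RHS]signr_odd -os chiE.
have [r1 c1] := shape_Iirr_mult yD tD.
pose R := row_stabiliser A t; pose C := col_stabiliser A t.
have sR : R \subset SymG A := line_stab_sub A _.
have sC : C \subset SymG A := line_stab_sub A _.
have RC : R :=: (C :^ s)%g.
  by apply: line_stabJ => // a Aa; rewrite sE.
have CR : C :=: (R :^ s)%g.
  by apply: line_stabJ => // a Aa; rewrite sE.
have sV : (s^-1 = s)%g by apply/eqP; rewrite eq_invg_mul ss.
pose P (rc : 'S_n * 'S_n) := (rc.1 \in R) && (rc.2 \in C).
pose x (rc : 'S_n * 'S_n) : algC := (-1) ^+ rc.2.
pose h (rc : 'S_n * 'S_n) := (rc.1 * rc.2 * s)%g.
have Ph rc : P rc -> h rc \in SymG A.
  by move=> /andP[/(subsetP sR) Sr /(subsetP sC) Sc]; apply/groupM/Ss/groupM.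
pose ER := weighted_sum (1 : 'CF(R)) rG; pose EC := weighted_sum (sign_cfun C) rG.
have ME : \sum_(rc | P rc) x rc *: rG (h rc) = ER *m EC *m rG s.
  rewrite -(pair_big (mem R) (mem C) (fun r c => (-1) ^+ c *: rG (r * c * s)%g)) /=.
  rewrite /ER /EC /weighted_sum !mulmx_suml; apply: eq_bigr => r Rr.
  rewrite mulmx_sumr mulmx_suml; apply: eq_bigr => c Cc.
  have [Sr Sc] := (subsetP sR r Rr, subsetP sC c Cc).
  rewrite cfun1E Rr scale1r sign_cfunE // !repr_mxM ?groupM //.
  by rewrite -scalemxAr -scalemxAl.
apply: (twisted_indicator1 irrG lin_s s_sq chi_real (x := x) Ph).
- move=> g Sg; rewrite -chiE; transitivity ((sign_cfun (SymG A) * 'chi_i) g).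
    by rewrite [RHS]cfunE.
  by rewrite sgn_chi fD.
- by rewrite -expr2 sqrr_sign.
- rewrite ME -mulmxA; apply/eqP; rewrite eqn_leq lt0n mxrank_eq0; apply/andP; split.
    apply: leq_trans (mxrankM_maxl _ _) _.
    have lin1 : (1 : 'CF(R)) \is a linear_char by exact: rpred1.
    have := mxrank_weighted_sum rG sR lin1; rewrite mxtrace_weighted_sum //.
    have <- : #|R|%:R = \sum_(g in R) (1 : 'CF(R)) g * cfRepr rG g.
      have := r1; rewrite row_multE => /(canRL (mulVKf (neq0CG R))).
      rewrite mulr1 => <-; apply: eq_bigr => g Rg; rewrite chiE.
      by rewrite cfun1E Rg mul1r.
    rewrite -[X in X = _]mulr1 => /(mulfI (neq0CG R))/eqP.
    by rewrite eq_sym (eqr_nat _ _ 1) => /eqP->.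
  have := young_symmetriser_neq0 yD tD irrG; rewrite -chiE r1 c1 oner_eq0 => /(_ isT isT).
  apply: contraNneq => e; rewrite -/R -/C -/ER -/EC.
  have : ER *m (EC *m rG s) *m rG s = 0 by rewrite e mul0mx.
  by rewrite -!mulmxA -repr_mxM // ss repr_mx1 mulmx1 => ->.
(* The reindexing for which the inverse of h (f (r, c)) is h (r, c). *)
pose f (rc : 'S_n * 'S_n) := (rc.2^-1 ^ s, rc.1^-1 ^ s)%g.
have inj_f : injective f.
  by move=> [r c] [r' c'] [/conjg_inj/invg_inj -> /conjg_inj/invg_inj ->].
have Pf rc : P (f rc) = P rc.
  case: rc => r c; rewrite /P /= andbC.
  have -> : (r^-1 ^ s \in C)%g = (r \in R) by rewrite CR memJ_conjg groupV.
  by have -> : (c^-1 ^ s \in R)%g = (c \in C) by rewrite RC memJ_conjg groupV.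
rewrite (reindex_inj inj_f) scaler_sumr; apply: eq_big => // [[r c]].
rewrite Pf => /andP[/= Rr Cc]; rewrite scalerA; congr (_ *: _).
  rewrite sign_cfunE ?Ph ?Pf ?/P ?Rr // /h /x /= !(odd_permJ, odd_permM, odd_permV).
  rewrite -!signr_addb; congr (_ ^+ nat_of_bool _).
  by case: (odd_perm r); case: (odd_perm c); case: (odd_perm s).
congr (rG _); rewrite /h /= -conjMg -invMg conjVg invMg invgK conjgE !sV !mulgA ss.
by rewrite mul1g.
Qed.

End TwistedIndicator.

(** * Pairing a square with the sign-twisted standard character *)

Section StandardCharacter.

Variable n : nat.
Notation box := ('I_n * 'I_n)%type.
Implicit Types (A : {set 'I_n}) (D E : {set box}) (a b : 'I_n).

Lemma card_flip D : #|(@flip n) @: D| = #|D|.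
Proof. by apply: card_imset; apply: can_inj (@flipK n). Qed.

Definition standard_cfun A : 'CF(SymG A) := fixed_cfun A - 1.

Lemma cfdot_fixed1 A a : a \in A -> '[fixed_cfun A, 1] = 1.
Proof.
by move=> Aa; rewrite -[fixed_cfun A]mul1r (cfdot_fixed _ _ Aa) !cfRes_cfun1 cfnorm1.
Qed.

Lemma Res_fixed A a : a \in A ->
  'Res[SymG (A :\ a)] (fixed_cfun A) = 1 + fixed_cfun (A :\ a).
Proof.
move=> Aa; apply/cfun_inP=> g Sg; rewrite cfResE ?(Sym_sub (subD1set A a)) //.
rewrite [RHS]cfunE cfun1E Sg !fixed_cfunE //; last by move: Sg; rewrite Sym_D1 => /andP[].
move: Sg; rewrite Sym_D1 => /andP[_ /eqP ga].
by rewrite !num_fixedE (big_setD1 a) //= ga eqxx.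
Qed.

(** The norm of pi is '[1, 1 + pi'] = 2, where pi' counts the fixed points other
    than a, and the trivial character is a constituent. *)
Lemma standard_irr A a b : a \in A -> b \in A :\ a -> standard_cfun A \in irr (SymG A).
Proof.
move=> Aa Bb; rewrite irrEchar; apply/andP; split.
  have pi_char : fixed_cfun A \is a character by rewrite (fixed_cfun_Ind Aa) cfInd_char ?rpred1.
  have /(constt_charP _ pi_char)[chi Nchi e] : 0 \in irr_constt (fixed_cfun A).
    by rewrite irr_consttE irr0 (cfdot_fixed1 Aa) oner_eq0.
  by rewrite /standard_cfun e irr0 addrC addKr.
have pp : '[fixed_cfun A] = 2.
  rewrite -{1}[fixed_cfun A]mul1r (cfdot_fixed _ _ Aa) cfRes_cfun1 Res_fixed //.
  by rewrite cfdotDr cfnorm1 cfdotC (cfdot_fixed1 Bb) conjC1.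
have p1 := cfdot_fixed1 Aa.
rewrite cfnormB pp p1 cfnorm1 conjC1; apply/eqP; ring.
Qed.

Definition sign_standard A := sign_cfun (SymG A) * standard_cfun A.

Lemma sign_standard_irr A a b : a \in A -> b \in A :\ a -> sign_standard A \in irr (SymG A).
Proof.
by move=> Aa Bb; rewrite mul_lin_irr ?sign_cfun_lin ?(standard_irr Aa Bb).
Qed.

Lemma sign_standardE A g : g \in SymG A -> sign_standard A g = (-1) ^+ g * (num_fixed A g - 1).
Proof.
move=> Sg; rewrite [LHS]cfunE sign_cfunE // [standard_cfun A g]cfunE fixed_cfunE //.
by rewrite [(- 1 : 'CF(SymG A)) g]cfunE cfun1E Sg.
Qed.

(** Moving the factors sigma and pi across the inner product leaves the restrictions
    of two diagram characters. *)
Lemma square_coord A a D (sD : D \in shapes n #|A|) (chi := 'chi_(shape_Iirr A D)) : a \in A ->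
  '[chi * chi, sign_standard A]
    = #|[set E in shapes n #|A :\ a| | (E \subset D) && (E \subset (@flip n) @: D)]|%:R
      - ((@flip n) @: D == D)%:R.
Proof.
move=> Aa; have [yD cD] := shapesP _ _ sD.
have yF : young ((@flip n) @: D) := young_flip yD.
have cF : #|(@flip n) @: D| = #|A| by rewrite card_flip.
have sF : (@flip n) @: D \in shapes n #|A| by apply/shapesP.
have chiC g : g \in SymG A -> (chi g)^* = chi g.
  by move=> Sg; have := shape_real yD cD Sg; rewrite irr_inv.
have -> : '[chi * chi, sign_standard A]
    = '[sign_cfun (SymG A) * chi * fixed_cfun A, chi] - '[sign_cfun (SymG A) * chi, chi].
  rewrite -cfdotBl !cfdotE; congr (_ * _); apply: eq_bigr => g Sg.
  rewrite sign_standardE // !cfunE Sg !mulr1n chiC // rmorphM rmorphB rmorph_sign rmorph1.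
  rewrite /num_fixed rmorph_nat; set x := _%:R; set y : algC := (-1) ^+ g; by ring.
rewrite sign_shape // cfdot_irr (inj_in_eq (@shape_Iirr_injin n A)) //; congr (_ - _).
rewrite (cfdot_fixed _ _ Aa) cfdot_sum_irr.
have [shB _] := branching (A :\ a); have [_ br] := branching A.
rewrite big_shapes // natr_card_setId; apply: eq_bigr => E sE.
by rewrite !br // conjC_nat -natrM mulnb andbC.
Qed.

Lemma sign_indicator_Res A a D (sD : D \in shapes n #|A|) : a \in A ->
  sign_indicator ('Res[SymG (A :\ a)] 'chi_(shape_Iirr A D))
    = \sum_(E in shapes n #|A :\ a| | E \subset D) sign_indicator 'chi_(shape_Iirr (A :\ a) E).
Proof.
move=> Aa; have [shB _] := branching (A :\ a); have [_ br] := branching A.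
rewrite /sign_indicator -mulr_sumr; congr (_ * _).
rewrite exchange_big; apply: eq_bigr => g Sg /=; rewrite -mulr_sumr; congr (_ * _).
rewrite ['Res _]cfun_sum_cfdot sum_cfunE big_shapes // big_mkcondr.
apply: eq_bigr => E sE; rewrite cfunE br //.
by case: (_ \subset _); rewrite ?mul1r ?mul0r.
Qed.

(** The mean of sigma(g) chi(g^2) pi(g) is the mean of sigma(g) chi(g^2) over a point
    stabiliser, that is, the indicator of the restriction. *)
Lemma square_twist A a D (sD : D \in shapes n #|A|) (chi := 'chi_(shape_Iirr A D)) : a \in A ->
  #|SymG A|%:R^-1 * (\sum_(g in SymG A) chi (g ^+ 2)%g * (sign_standard A g)^* )
   = \sum_(E in shapes n #|A :\ a| | (E \subset D) && ((@flip n) @: E == E))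
        (-1) ^+ ((#|A :\ a| - #|diagonal E|) %/ 2)
     - (if (@flip n) @: D == D then (-1) ^+ ((#|A| - #|diagonal D|) %/ 2) else 0).
Proof.
move=> Aa; rewrite -sign_indicator_shape // -/chi.
transitivity (sign_indicator ('Res[SymG (A :\ a)] chi) - sign_indicator chi); last first.
  rewrite sign_indicator_Res //; congr (_ - _).
  rewrite !big_mkcondr; apply: eq_bigr => E sE.
  by rewrite sign_indicator_shape //; case: (_ \subset _).
have -> : sign_indicator ('Res[SymG (A :\ a)] chi)
   = #|SymG A|%:R^-1 * \sum_(g in SymG A) ((-1) ^+ g * chi (g * g)%g) * num_fixed A g.
  rewrite (sum_num_fixed Aa) => [|g h Sg Sh]; last first.
    by rewrite odd_permJ -conjMg cfunJ.
  congr (_ * _); apply: eq_bigr => g Sg; rewrite cfResE ?groupM //.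
  exact: Sym_sub (subD1set A a).
rewrite -mulrBr -sumrB; congr (_ * _); apply: eq_bigr => g Sg.
rewrite sign_standardE // rmorphM rmorphB rmorph_sign rmorph1 expgS expg1.
by rewrite /num_fixed rmorph_nat; set x := _%:R; set y : algC := (-1) ^+ g; ring.
Qed.

End StandardCharacter.

(** * Diagrams of partitions *)

Lemma nth_leq_sumn (s : seq nat) i : (nth 0 s i <= sumn s)%N.
Proof.
elim: s i => [|x s IH] [|i] //=; first exact: leq_addr.
exact: leq_trans (IH i) (leq_addl _ _).
Qed.

Lemma size_leq_sumn (s : seq nat) : 0%N \notin s -> (size s <= sumn s)%N.
Proof.
elim: s => //= x s IH; rewrite in_cons negb_or eq_sym -lt0n => /andP[x0 /IH].
by rewrite -add1n; apply: leq_add.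
Qed.

Lemma nth_sorted_geq (s : seq nat) i j : sorted geq s -> (i <= j)%N ->
  (nth 0 s j <= nth 0 s i)%N.
Proof.
move=> srt le_ij; have [lt_j | ge_j] := ltnP j (size s); last by rewrite (nth_default _ ge_j).
have geq_tr : transitive geq by move=> x y z xy yz; apply: leq_trans yz xy.
exact: (sorted_leq_nth geq_tr leqnn 0%N srt _ _ (leq_ltn_trans le_ij lt_j) lt_j le_ij).
Qed.

(** The rows longer than i form an initial segment. *)
Lemma ltn_count_sorted (s : seq nat) i j : sorted geq s ->
  (j < count (fun p => i < p) s)%N = (i < nth 0 s j)%N.
Proof.
elim: s j => [|x s IH] j /= srt; first by rewrite nth_nil.
have min : all (geq x) s by apply: order_path_min srt => a b c ab bc; apply: leq_trans bc ab.
have [lt_ix | ge_ix] := ltnP i x.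
  by case: j => [|j] //=; rewrite add1n ltnS IH // (path_sorted srt).
have -> : count (fun p => i < p)%N s = 0%N.
  apply/eqP; rewrite -leqn0 leqNgt -has_count; apply/hasPn=> p /(allP min) le_p.
  by rewrite -leqNgt; apply: leq_trans ge_ix.
rewrite addn0 ltn0; apply/esym/negbTE; rewrite -leqNgt; apply: leq_trans ge_ix.
case: j => [|j] //=; have [lt_j | ge_j] := ltnP j (size s); last by rewrite nth_default.
exact: (allP min) _ (mem_nth _ lt_j).
Qed.

Lemma nth_conj_part (s : seq nat) i : sorted geq s ->
  nth 0 (conj_part s) i = count (fun p => i < p)%N s.
Proof.
move=> srt; have [lt_i | ge_i] := ltnP i (head 0%N s); first by rewrite nth_mkseq.
rewrite nth_default ?size_mkseq //; apply/esym/eqP; rewrite -leqn0 leqNgt.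
by rewrite ltn_count_sorted // -leqNgt nth0.
Qed.

Section PartitionDiagram.

Variable n : nat.
Notation box := ('I_n * 'I_n)%type.
Implicit Types (la : seq nat) (D E : {set box}).

Lemma mem_diagram la (b : box) : (b \in diagram n la) = (b.2 < nth 0 la b.1)%N.
Proof. by rewrite inE. Qed.

Lemma young_diagram la : sorted geq la -> young (diagram n la).
Proof.
move=> srt; apply/youngP=> b c; rewrite !mem_diagram => lt_b le1 le2.
exact: leq_ltn_trans le2 (leq_trans lt_b (nth_sorted_geq srt le1)).
Qed.

Lemma mem_flip D (b : box) : (b \in (@flip n) @: D) = (flip b \in D).
Proof. by rewrite -{1}[b]flipK mem_imset //; apply: can_inj (@flipK n). Qed.

Lemma diagram_conj la : sorted geq la -> diagram n (conj_part la) = (@flip n) @: diagram n la.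
Proof.
move=> srt; apply/setP=> b; rewrite mem_flip !mem_diagram nth_conj_part //.
by rewrite ltn_count_sorted.
Qed.

(** The row lengths form the required decreasing sequence; each is at most n, so it
    fits in the type of the parts. *)
Lemma is_diagram_young E : is_diagram E = young E.
Proof.
apply/existsP/idP=> [[mu /andP[srt /eqP ->]] | yE]; first exact: young_diagram.
pose rl (i : nat) := #|[set c in E | c.1 == i :> nat]|.
have rlE b : (b \in E) = (b.2 < rl b.1)%N by rewrite young_row.
have le_rl i : (rl i <= n)%N.
  have inj : {in [set c in E | c.1 == i :> nat] &, injective (fun c : box => c.2)}.
    move=> b c /setIdP[_ /eqP eb] /setIdP[_ /eqP ec] /= e.
    rewrite [b]surjective_pairing [c]surjective_pairing e; congr (_, _).
    by apply: val_inj; rewrite /= eb ec.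
  by rewrite /rl -(card_in_imset inj) -[X in (_ <= X)%N]card_ord max_card.
exists [tuple inord (rl i) | i < n].
have -> : [seq val p | p <- [tuple (inord (rl i) : 'I_n.+1) | i < n]] = mkseq rl n.
  rewrite /mkseq -val_enum_ord -!map_comp; apply: eq_map => i /=.
  by rewrite inordK // ltnS.
apply/andP; split.
  apply/(sortedP 0%N) => i; rewrite size_mkseq => lt_i.
  rewrite !nth_mkseq ?(ltnW lt_i) // /geq /= leqNgt; apply/negP=> lt_rl.
  have lt_j : (rl i < n)%N by apply: leq_trans lt_rl (le_rl _).
  have : (Ordinal lt_i, Ordinal lt_j) \in E by rewrite rlE.
  move=> Eb; have /youngP/(_ _ (Ordinal (ltnW lt_i), Ordinal lt_j) Eb) := yE.
  by move/(_ (leqnSn _) (leqnn _)); rewrite rlE ltnn.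
apply/eqP/setP=> b; rewrite mem_diagram nth_mkseq //; exact: rlE.
Qed.

Lemma removableE la : removable n la = corners (diagram n la).
Proof. by apply/setP=> b; rewrite !inE is_diagram_young. Qed.

Lemma durfeeE la : durfee n la = #|diagonal (diagram n la)|.
Proof.
have inj : injective (fun i : 'I_n => (i, i)) by move=> i j [].
rewrite /durfee -(card_imset _ inj); apply: eq_card => b; apply/imsetP/setIdP.
  by move=> [i + ->]; rewrite inE.
move=> [Db /eqP e]; have Eb : b = (b.1, b.1) by rewrite {1}[b]surjective_pairing -e.
by exists b.1; rewrite // inE -Eb.
Qed.

(** The filling of the diagram by numbering its boxes row by row. Both coordinates
    are smaller than n, so the default values of insubd are never used. *)
Definition box_of la (k : 'I_n) : box :=
  (insubd k (reshape_index la k), insubd k (reshape_offset la k)).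

Section OnePartition.

Variable la : seq nat.
Hypothesis la_part : is_partition n la.

Let srt : sorted geq la. Proof. by case/and3P: la_part. Qed.
Let sum_la : sumn la = n. Proof. by case/and3P: la_part => _ _ /eqP. Qed.
Let size_la : (size la <= n)%N.
Proof. by rewrite -sum_la; case/and3P: la_part => _ /size_leq_sumn. Qed.
Let nth_la i : (nth 0 la i <= n)%N. Proof. by rewrite -sum_la nth_leq_sumn. Qed.

Lemma box_ofE (k : 'I_n) :
  (box_of la k).1 = reshape_index la k :> nat /\ (box_of la k).2 = reshape_offset la k :> nat.
Proof.
have lt_k : (k < sumn la)%N by rewrite sum_la.
rewrite !val_insubd (leq_trans (reshape_indexP lt_k) size_la).
by rewrite (leq_trans (reshape_offsetP lt_k) (nth_la _)).
Qed.

Lemma filling_box_of : filling setT (diagram n la) (box_of la).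
Proof.
split=> [k l _ _ e|].
  have [[k1 k2] [l1 l2]] := (box_ofE k, box_ofE l).
  by apply: val_inj; rewrite /= -(reshape_indexK la k) -(reshape_indexK la l) -k1 -k2 -l1 -l2 e.
apply/setP=> b; rewrite mem_diagram; apply/imsetP/idP=> [[k _ ->] | lt_b].
  by have [-> ->] := box_ofE k; apply: reshape_offsetP; rewrite sum_la.
have lt_k : (flatten_index la b.1 b.2 < n)%N by rewrite -[X in (_ < X)%N]sum_la flatten_indexP.
exists (Ordinal lt_k) => //; have [e1 e2] := box_ofE (Ordinal lt_k).
rewrite [LHS]surjective_pairing [RHS]surjective_pairing.
by congr (_, _); apply: val_inj; rewrite /= ?e1 ?e2 ?flatten_indexKl ?flatten_indexKr.
Qed.

Lemma card_diagram : #|diagram n la| = #|[set: 'I_n]|.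
Proof. exact: card_filling filling_box_of. Qed.

Lemma shape_diagram : diagram n la \in shapes n #|[set: 'I_n]|.
Proof. by apply/shapesP; split; [apply: young_diagram | apply: card_diagram]. Qed.

Lemma SymG_setT : SymG [set: 'I_n] = [set: 'S_n]%G.
Proof.
by apply: group_inj; apply/setP=> s; rewrite !inE; apply/subsetP=> x; rewrite inE.
Qed.

Lemma row_stabE : row_stab n la = row_stabiliser setT (box_of la).
Proof.
apply: group_inj; apply/setP=> s; rewrite inE; apply/forallP/line_stabP=> [H | [_ H] k].
  rewrite SymG_setT inE; split=> // k; apply: val_inj => /=.
  by have [-> _] := box_ofE (s k); have [-> _] := box_ofE k; apply/eqP.
have := congr1 val (H k) => /=.
by have [-> _] := box_ofE (s k); have [-> _] := box_ofE k => /eqP.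
Qed.

Lemma col_stabE : col_stab n la = col_stabiliser setT (box_of la).
Proof.
apply: group_inj; apply/setP=> s; rewrite inE; apply/forallP/line_stabP=> [H | [_ H] k].
  rewrite SymG_setT inE; split=> // k; apply: val_inj => /=.
  by have [_ ->] := box_ofE (s k); have [_ ->] := box_ofE k; apply/eqP.
have := congr1 val (H k) => /=.
by have [_ ->] := box_ofE (s k); have [_ ->] := box_ofE k => /eqP.
Qed.

(** A partition is recovered from its diagram: all its parts, and those of its
    conjugate, are at most n, and its number of parts is the first part of the
    conjugate. *)
Lemma conj_part_eqP : (la = conj_part la) <-> ((@flip n) @: diagram n la = diagram n la).
Proof.
rewrite -diagram_conj //; split=> [<- // | eqD].
have eq_nth i : (i < n)%N -> nth 0 la i = nth 0 (conj_part la) i.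
  move=> lt_i; have le_c : (nth 0 (conj_part la) i <= n)%N.
    by rewrite nth_conj_part //; apply: leq_trans (count_size _ _) size_la.
  have eqb j : (j < n)%N -> (j < nth 0 la i)%N = (j < nth 0 (conj_part la) i)%N.
    move=> lt_j; have /setP/(_ (Ordinal lt_i, Ordinal lt_j)) := eqD.
    by rewrite !mem_diagram /= => ->.
  apply/eqP; rewrite eqn_leq; apply/andP; split; rewrite leqNgt; apply/negP=> lt.
    have lt_n := leq_trans lt (nth_la i).
    by have := eqb _ lt_n; rewrite lt ltnn.
  have lt_n := leq_trans lt le_c.
  by have := eqb _ lt_n; rewrite lt ltnn.
have [n0 | n_gt0] := posnP n.
  suff -> : la = [::] by [].
  by apply: size0nil; apply/eqP; rewrite -leqn0 -n0.
have eq_size : size la = size (conj_part la).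
  rewrite size_mkseq -nth0 eq_nth // nth_conj_part //; apply/esym/eqP.
  rewrite -all_count; apply/allP=> x xla; rewrite lt0n; apply: contraTneq xla => ->.
  by case/and3P: la_part.
apply: (eq_from_nth (x0 := 0%N)) eq_size _ => i lt_i; apply: eq_nth.
exact: leq_trans lt_i size_la.
Qed.

End OnePartition.

End PartitionDiagram.

(** * The character of the hook with one box outside its first column *)

Lemma hook_partition m : is_partition m.+2 (2%N :: nseq m 1%N).
Proof.
apply/and3P; split; last by rewrite /= sumn_nseq mul1n addnC addn2.
  by rewrite /= path_min_sorted ?all_nseq ?orbT //; elim: m => [|[|m] IH].
by rewrite in_cons negb_or /= mem_nseq andbF.
Qed.

(** A filling with the point 1 in the second box of the first row and all other
    points in the first column. Its row group consists of the identity and the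
    transposition of 0 and 1, its column group is the stabiliser of 1, and both
    multiplicities of sigma (pi - 1) are computed directly. *)
Lemma hook_char m :
  'chi_(shape_Iirr [set: 'I_m.+2] (diagram m.+2 (2%N :: nseq m 1%N))) = sign_standard setT.
Proof.
set mu := _ :: _; have mu_part : is_partition m.+2 mu := hook_partition m.
pose T := [set: 'I_m.+2]; rewrite -/T.
pose i0 : 'I_m.+2 := ord0; pose i1 : 'I_m.+2 := lift ord0 ord0.
pose t (k : 'I_m.+2) : 'I_m.+2 * 'I_m.+2 := (inord k.-1, inord (k == 1 :> nat)).
have t1 k : (t k).1 = k.-1 :> nat.
  by rewrite inordK // ltnS; apply: leq_trans (leq_pred _) _; rewrite -ltnS.
have t2 k : (t k).2 = (k == 1 :> nat) :> nat by rewrite inordK //; case: (_ == _).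
have inj_t : injective t.
  move=> k l e; have e1 : k.-1 = l.-1 by rewrite -!t1 e.
  have e2 : (k == 1 :> nat) = (l == 1 :> nat) :> nat by rewrite -!t2 e.
  apply: ord_inj; move: e1 e2; case: (k : nat) (l : nat) => [|[|k']] [|[|l']] //=.
  by move=> ->.
have tD : filling T (diagram m.+2 mu) t.
  split; first by move=> k l _ _; apply: inj_t.
  apply/eqP; rewrite eqEcard (card_diagram mu_part) card_imset // leqnn andbT.
  apply/subsetP=> _ /imsetP[k _ ->]; rewrite mem_diagram t1 t2.
  have := ltn_ord k; case: (k : nat) => [|[|k']] //= lt_k.
  by rewrite nth_nseq ifT.
have yD : young (diagram m.+2 mu) by apply: young_diagram; case/and3P: mu_part.
have T0 : i0 \in T by rewrite inE.
have T1 : i1 \in T by rewrite inE.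
have T01 : i0 \in T :\ i1 by rewrite !inE.
have /irrP[i Ei] := sign_standard_irr T1 T01.
rewrite Ei; congr 'chi_ _; apply/esym/eqP; rewrite -(shape_IirrE _ yD tD) /labelled -Ei.
have memT (s : 'S_m.+2) : s \in SymG T by rewrite SymG_setT inE.
apply/andP; split.
  have -> : row_mult t (sign_standard T) = #|row_stabiliser T t|%:R^-1 * 2.
    rewrite row_multE; congr (_ * _).
    have -> : row_stabiliser T t = [set 1%g; tperm i0 i1] :> {set 'S_m.+2}.
      apply/setP=> s; rewrite in_set2; apply/line_stabP/orP=> [[_ rs] | ].
        have sk (k : 'I_m.+2) : (s k).-1 = k.-1 by rewrite -!t1 rs.
        have sk2 (k : 'I_m.+2) : (1 < k)%N -> s k = k.
          move=> k1; apply: ord_inj; have := sk k.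
          by case: (k : nat) k1 => [|[|k']] // _; case: (s k : nat) => [|l] //= ->.
        have [s0 | s0] := eqVneq (s i0) i0.
          left; apply/eqP/permP=> k; rewrite perm1.
          have [k1 | /sk2 //] := leqP k 1.
          have [-> // | k0] := eqVneq k i0.
          have : s k != i0 by rewrite -s0 (inj_eq perm_inj).
          have := sk k; rewrite -!val_eqE /= in k0 *; move=> e sk0; apply: ord_inj; lia.
        right; apply/eqP/permP=> k.
        have e0 : s i0 = i1.
          by apply: ord_inj; have := sk i0; rewrite -val_eqE /= in s0 *; rewrite /bump /=; lia.
        have e1 : s i1 = i0.
          have : s i1 != i1 by rewrite -[X in _ != X]e0 (inj_eq perm_inj).
          by have := sk i1; rewrite -val_eqE /= /bump /= => e ne; apply: ord_inj => /=; lia.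
        case: tpermP => [-> // | -> // | k0 k1]; apply: sk2.
        by move/eqP: k0; move/eqP: k1; rewrite -!val_eqE /= /bump /=; lia.
      move=> Hs; split=> [|k]; first exact: memT.
      apply: ord_inj; rewrite !t1; case: Hs => /eqP->; rewrite ?perm1 //.
      by case: tpermP => [->|->|].
    rewrite big_setU1 /=; last first.
      by rewrite inE eq_sym; apply/eqP => /permP/(_ i0); rewrite tpermL perm1.
    rewrite big_set1 !sign_standardE ?memT // odd_perm1 odd_tperm.
    have -> : num_fixed T 1%g = m.+2%:R.
      rewrite /num_fixed (_ : [set a in T | _] = T) ?cardsT ?card_ord //.
      by apply/setP=> a; rewrite !inE perm1 eqxx.
    have -> : num_fixed T (tperm i0 i1) = m%:R.
      rewrite /num_fixed (_ : [set a in T | _] = T :\ i0 :\ i1).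
        have := cardsD1 i0 T; have := cardsD1 i1 (T :\ i0).
        rewrite !inE /= cardsT card_ord => -> e; congr (_%:R); by move: e; rewrite !add1n => -[].
      apply/setP=> a; rewrite !inE; case: tpermP => [->|->|/eqP a0 /eqP a1].
      - by rewrite eqxx andbF.
      - by rewrite eqxx.
      by rewrite eqxx a0 a1.
    rewrite (_ : (i0 != i1) = true) // -!natr1 /=; ring.
  by rewrite mulf_neq0 ?invr_eq0 ?neq0CG ?pnatr_eq0.
have -> : col_mult t (sign_standard T) = '[fixed_cfun (T :\ i1), 1].
  have -> : col_mult t (sign_standard T) = #|SymG (T :\ i1)|%:R^-1 *
      \sum_(g in SymG (T :\ i1)) (-1) ^+ g * sign_standard T g.
    rewrite col_multE; suff -> : col_stabiliser T t = SymG (T :\ i1) by [].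
    have memT1 s : (s \in SymG (T :\ i1)) = (s i1 == i1) by rewrite Sym_D1 memT.
    apply: group_inj; apply/setP=> s; rewrite [RHS]memT1.
    apply/line_stabP/eqP=> [[_ cs] | s1].
      have e : (t (s i1)).2 = (t i1).2 :> nat by rewrite cs.
      by rewrite !t2 in e; apply: ord_inj; move: e; case: eqP => [->|_].
    split=> // k; apply: ord_inj; rewrite !t2; congr (nat_of_bool _).
    have e1 (l : 'I_m.+2) : (l == 1 :> nat) = (l == i1) by rewrite -val_eqE.
    by rewrite !e1 -{1}s1 (inj_eq perm_inj).
  rewrite cfdotE; congr (_ * _); apply: eq_bigr => g Sg.
  rewrite sign_standardE ?memT // mulrA -signr_addb addbb mul1r cfun1E Sg conjC1 mulr1.
  rewrite fixed_cfunE //.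
  move: Sg; rewrite Sym_D1 => /andP[_ /eqP g1].
  by rewrite !num_fixedE (big_setD1 i1) //= g1 eqxx mulr1n [1 + _]addrC addrK.
by rewrite (cfdot_fixed1 T01) oner_eq0.
Qed.

(** * Subdiagrams shared with the conjugate *)

Section CommonSubshapes.

Variable n : nat.
Notation box := ('I_n * 'I_n)%type.
Implicit Types (D E : {set box}) (b c : box).

Lemma mem_diagonal D b : (b \in diagonal D) = (b \in D) && (b.1 == b.2).
Proof. by rewrite in_set. Qed.

Lemma in_setId (T : finType) (A : {set T}) (P : pred T) x :
  (x \in [set y in A | P y]) = (x \in A) && P x.
Proof. by rewrite in_set. Qed.

Definition core D := D :&: (@flip n) @: D.

Lemma young_setI D E : young D -> young E -> young (D :&: E).
Proof.
move=> /youngP yD /youngP yE; apply/youngP=> b c /setIP[Db Eb] le1 le2.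
by apply/setIP; split; [apply: yD Db le1 le2 | apply: yE Eb le1 le2].
Qed.

Lemma flip_inj : injective (@flip n). Proof. exact: can_inj (@flipK n). Qed.

Lemma flip_core D : (@flip n) @: core D = core D.
Proof. by apply/setP=> b; rewrite mem_flip !inE !mem_flip flipK andbC. Qed.

Lemma diagonal_core D : diagonal (core D) = diagonal D.
Proof.
apply/setP=> b; rewrite !inE mem_flip; case: (b.1 =P b.2) => [e|]; rewrite ?andbF // !andbT.
suff -> : flip b = b by rewrite andbb.
by rewrite [RHS]surjective_pairing /flip e.
Qed.

Lemma sub_core D E : (E \subset core D) = (E \subset D) && (E \subset (@flip n) @: D).
Proof. exact: subsetI. Qed.

Lemma sub_core_symmetric D E : (@flip n) @: E == E -> (E \subset core D) = (E \subset D).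
Proof.
move=> /eqP fE; rewrite sub_core; case sED: (E \subset D) => //=.
by rewrite -fE imsetS.
Qed.

Lemma core_subshape D k : young D -> #|core D| = k ->
  [set E in shapes n k | E \subset core D] = [set core D].
Proof.
move=> yD cK; apply/setP=> E; rewrite in_set1; apply/setIdP/eqP=> [[/shapesP[_ cE] sE] | ->].
  by apply/eqP; rewrite eqEcard sE cK cE leqnn.
by split=> //; apply/shapesP; split=> //; apply: young_setI (young_flip yD).
Qed.

Lemma core_full D : (#|core D| == #|D|) = ((@flip n) @: D == D).
Proof.
apply/eqP/eqP=> [cK | fD]; last by rewrite /core fD setIid.
have KD : core D = D by apply/eqP; rewrite eqEcard subsetIl cK leqnn.
by rewrite -{1}KD flip_core KD.
Qed.

Lemma flip_corners D b : (@flip n) @: D = D -> (flip b \in corners D) = (b \in corners D).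
Proof.
move=> fD; have Dfb c : (flip c \in D) = (c \in D) by rewrite -mem_flip fD.
have im c : (@flip n) @: (D :\ c) = D :\ flip c.
  apply/setP=> x; rewrite mem_flip !inE Dfb -[flip x == c](inj_eq flip_inj) flipK.
  by [].
rewrite !inE Dfb; congr (_ && _); apply/idP/idP=> [/young_flip | /young_flip].
  by rewrite im flipK.
by rewrite im.
Qed.

(** Flipping is an involution of the corners, so the corners off the diagonal come
    in pairs; two diagonal corners are comparable, hence equal. *)
Lemma card_diagonal_corners D : (@flip n) @: D = D ->
  #|diagonal (corners D)| = odd #|corners D|.
Proof.
move=> fD; have le1 : (#|diagonal (corners D)| <= 1)%N.
  apply/card_le1_eqP => b c /setIdP[cb /eqP eb] /setIdP[cc /eqP ec].
  have [Db _] := setIdP cb; have [Dc _] := setIdP cc.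
  have [le | /ltnW le] := leqP b.1 c.1.
    by rewrite (corner_max cb Dc) // -eb -ec.
  by rewrite (corner_max cc Db) // -eb -ec.
pose f b := if b \in corners D then flip b else b.
have fK : involutive f.
  move=> b; rewrite /f; case cb: (b \in corners D); last by rewrite cb.
  by rewrite flip_corners // cb flipK.
have [] := @involution_sign _ (perm (inv_inj fK)).
  by apply/permP=> b; rewrite permM !permE fK.
rewrite (_ : [set _ | _] = corners D :\: diagonal (corners D)); last first.
  apply/setP=> b; rewrite in_set in_setD mem_diagonal permE /f.
  case cb: (b \in corners D); rewrite ?andbF ?eqxx // andbT /=; congr (~~ _).
  rewrite [b in flip b == b]surjective_pairing.
  by apply/eqP/eqP => [[-> ]|->].
move=> _; rewrite cardsDS ?subsetIl //; last by apply/subsetP=> b /setIdP[].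
have le : (#|diagonal (corners D)| <= #|corners D|)%N.
  by apply/subset_leq_card/subsetP=> b /setIdP[].
rewrite oddB // negb_add; move: le1.
by case: #|diagonal (corners D)| => [|[|x]] // _; case: (odd _).
Qed.

(** A symmetric diagram minus a corner is symmetric exactly if the corner lies on the
    diagonal. Deleting it lowers both the size and the diagonal length by 1. *)
Lemma sum_symmetric_subshapes D k : young D -> #|D| = k.+1 -> (@flip n) @: D = D ->
  \sum_(E in shapes n k | (E \subset D) && ((@flip n) @: E == E))
     (-1) ^+ ((k - #|diagonal E|) %/ 2)
  = (odd #|corners D|)%:R * (-1) ^+ ((k.+1 - #|diagonal D|) %/ 2) :> algC.
Proof.
move=> yD cD fD; rewrite -(card_diagonal_corners fD).
transitivity (\sum_(E in [set E in shapes n k | E \subset D] | (@flip n) @: E == E)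
   (-1) ^+ ((k - #|diagonal E|) %/ 2) : algC).
  by apply: eq_bigl => E; rewrite in_setId andbA.
rewrite subshapesE // big_mkcondr big_imset /=; last first.
  move=> b c /setIdP[Db _] /setIdP[Dc _] /setP/(_ b); rewrite setD11 in_setD1 Db andbT.
  by move/esym/negbFE/eqP.
rewrite mulr_natl -sumr_const big_mkcond [RHS]big_mkcond; apply: eq_bigr => b _.
rewrite mem_diagonal.
case cb: (b \in corners D) => //=; have [Db _] := setIdP cb.
have -> : ((@flip n) @: (D :\ b) == D :\ b) = (b.1 == b.2).
  apply/eqP/eqP=> [/setP/(_ b) | e].
    rewrite mem_flip setD11 in_setD1 -mem_flip fD Db andbT.
    by move/negbFE/eqP/(congr1 fst).
  have fb : flip b = b by rewrite [RHS]surjective_pairing /flip e.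
  apply/setP=> c; rewrite mem_flip !in_setD1 -[in LHS]mem_flip fD.
  by rewrite -[flip c == b](inj_eq flip_inj) flipK fb.
case: eqP => // e; congr (_ ^+ (_ %/ 2)).
have db : b \in diagonal D by rewrite inE Db e eqxx.
have -> : diagonal (D :\ b) = diagonal D :\ b.
  by apply/setP=> c; rewrite !inE andbA.
by have := cardsD1 b (diagonal D); rewrite db => ->; rewrite add1n subSS.
Qed.

End CommonSubshapes.

(** * The coefficients *)

Section SquareCoefficients.

Variable n : nat.

(** The label for an arbitrary group G, so that it can be moved along the equality
    of Sym(A) with the full symmetric group when A contains all points. *)
Definition group_Iirr (G : {group 'S_n}) (la : seq nat) : Iirr G :=
  odflt 0 [pick i |
    (i \in irr_constt ('Ind[G] (1 : 'CF(row_stab n la)))) &&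
    (i \in irr_constt ('Ind[G] (sign_cfun (col_stab n la))))].

Lemma group_IirrE la : is_partition n la ->
  group_Iirr (SymG setT) la = shape_Iirr setT (diagram n la).
Proof.
move=> la_part; have tD := filling_box_of la_part.
have yD : young (diagram n la) by apply: young_diagram; case/and3P: la_part.
have lab (i : Iirr (SymG setT)) :
    (i \in irr_constt ('Ind[SymG setT] (1 : 'CF(row_stab n la)))) &&
    (i \in irr_constt ('Ind[SymG setT] (sign_cfun (col_stab n la))))
    = (i == shape_Iirr setT (diagram n la)).
  rewrite -(shape_IirrE _ yD tD) row_stabE // col_stabE // /labelled !irr_consttE.
  congr (_ && _); rewrite -cfdot_Res_r cfdotC_char ?cfRes_char ?irr_char ?rpred1 //.
  by rewrite lin_charW ?sign_cfun_lin.
rewrite /group_Iirr; case: pickP => [i | /(_ (shape_Iirr setT (diagram n la)))].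
  by rewrite lab => /eqP.
by rewrite lab eqxx.
Qed.

Lemma square_coefficients (la mu : seq nat) (G := SymG [set: 'I_n])
    (chi := 'chi_(group_Iirr G la)) (psi := 'chi_(group_Iirr G mu))
    (S := '[chi * chi, psi])
    (T := #|G|%:R^-1 * \sum_(g in G) chi (g ^+ 2)%g * (psi g)^*) :
  sg n la mu = (S + T) / 2 /\ ag n la mu = (S - T) / 2.
Proof.
have -> : sg n la mu = coord (irr G) (group_Iirr G mu) (sym_square chi).
  rewrite /sg /part_char -![part_Iirr n _]/(group_Iirr [set: 'S_n]%G _).
  by rewrite /chi /G SymG_setT.
have -> : ag n la mu = coord (irr G) (group_Iirr G mu) (alt_square chi).
  rewrite /ag /part_char -![part_Iirr n _]/(group_Iirr [set: 'S_n]%G _).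
  by rewrite /chi /G SymG_setT.
rewrite !coord_cfdot -/psi /S /T !cfdotE -mulrDr -mulrBr -big_split -sumrB /=.
split; rewrite -mulrA mulr_suml; congr (_ * _); apply: eq_bigr => g Gg.
  by rewrite sym_squareE // cfunE expr2; ring.
by rewrite alt_squareE // cfunE expr2; ring.
Qed.

End SquareCoefficients.

Theorem theorem6p3 (n : nat) (la : seq nat)
    (hn : (2 <= n)%N) (hla : is_partition n la) :
  let d := durfee n la in
  let r1 := #|removable n la| in
  let m := #|diagram n la :&: diagram n (conj_part la)| in
  let mu := 2%N :: nseq (n - 2) 1%N in
  let eps : rat := (-1) ^+ ((n - d) %/ 2) in
  [/\ (m < n - 1)%N -> sg n la mu = 0 /\ ag n la mu = 0,
      m = (n - 1)%N ->
        (~~ odd ((n - 1 - d) %/ 2) -> sg n la mu = 1 /\ ag n la mu = 0) /\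
        (odd ((n - 1 - d) %/ 2) -> sg n la mu = 0 /\ ag n la mu = 1),
      m = n <-> la = conj_part la &
      m = n ->
        (odd r1 ->
           sg n la mu = (r1%:R - 1) / 2 /\ ag n la mu = (r1%:R - 1) / 2) /\
        (~~ odd r1 ->
           sg n la mu = (Num.floor ((r1%:R - eps) / 2))%:~R /\
           ag n la mu = (Num.floor ((r1%:R + eps) / 2))%:~R)].
Proof.
case: n hn hla => [|[|k]] // _; set n := k.+2 => hla d r1 m mu eps.
have srt : sorted geq la by case/and3P: hla.
pose D := diagram n la.
have sD : D \in shapes n #|[set: 'I_n]| := shape_diagram hla.
have cD : #|D| = n by rewrite (card_diagram hla) cardsT card_ord.
have yD : young D := young_diagram n srt.
have mE : m = #|core D| by rewrite /m diagram_conj.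
have dE : d = #|diagonal D| := durfeeE n la.
have rE : r1 = #|corners D| by rewrite /r1 removableE.
have a0 : (ord0 : 'I_n) \in setT by rewrite inE.
have cB : #|[set: 'I_n] :\ ord0| = k.+1.
  by have := cardsD1 (ord0 : 'I_n) setT; rewrite inE cardsT card_ord => -[].
have muE : mu = 2%N :: nseq k 1%N by rewrite /mu /n !subSS subn0.
have mu_part : is_partition n mu by rewrite muE; apply: hook_partition.
have [sgE agE] := square_coefficients n la mu.
have psiE : 'chi_(group_Iirr (SymG [set: 'I_n]) mu) = sign_standard setT.
  by rewrite group_IirrE // muE hook_char.
move: sgE agE; rewrite psiE group_IirrE // -/D.
rewrite (square_coord sD a0) (square_twist sD a0) cB cardsT card_ord -dE.
set P := [set E in _ | _]; set Tsum := \sum_(E in _ | _) _ => sgE agE.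
have PE : P = [set E in shapes n k.+1 | E \subset core D].
  by apply/setP=> E; rewrite !in_setId sub_core.
have TE : Tsum = \sum_(E in P | (@flip n) @: E == E) (-1) ^+ ((k.+1 - #|diagonal E|) %/ 2).
  apply: eq_bigl => E; rewrite PE in_setId -andbA; congr (_ && _).
  by rewrite andbC [RHS]andbC; case fE: (_ == E) => //=; rewrite sub_core_symmetric.
have fullE : ((@flip n) @: D == D) = (m == n) by rewrite -core_full mE cD.
have n1 : (n - 1 = k.+1)%N by rewrite /n subn1.
have two : (2 : algC) != 0 by rewrite pnatr_eq0.
split.
- rewrite n1 => lt_m.
  have P0 : P = set0.
    apply/setP=> E; rewrite PE in_setId in_set0; apply/negbTE/negP=> /andP[/shapesP[_ cE]].
    by move/subset_leq_card; rewrite cE -mE leqNgt lt_m.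
  move: sgE agE; rewrite TE P0 cards0 fullE (_ : (m == n) = false); last first.
    by rewrite ltn_eqF // ltnW.
  by rewrite big_pred0 => [|E]; rewrite ?inE //= mulr0n !subr0 addr0 mul0r => -> ->.
- rewrite n1 => em; have P1 : P = [set core D] by rewrite PE core_subshape // -mE.
  have Ts : Tsum = (-1) ^+ ((k.+1 - d) %/ 2).
    rewrite TE P1 (big_pred1 (core D)) => [|E]; first by rewrite diagonal_core dE.
    by rewrite in_set1 /=; case: eqP => // ->; rewrite flip_core eqxx.
  move: sgE agE; rewrite Ts P1 cards1 fullE (_ : (m == n) = false) ?subr0; last first.
    by rewrite em /n eqn_leq ltnn andbF.
  rewrite -signr_odd => -> ->; split=> [/negPf-> | ->]; rewrite ?expr0 ?expr1.
    by rewrite subrr mul0r mulfV.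
  by rewrite subrr mul0r opprK mulfV.
- rewrite (conj_part_eqP hla) -/D; split=> [em | eD]; apply/eqP.
    by rewrite fullE em.
  by rewrite -fullE eD.
move=> em; have eD : (@flip n) @: D = D by apply/eqP; rewrite fullE em.
have Ts : Tsum = (odd r1)%:R * (-1) ^+ ((n - d) %/ 2).
  by rewrite /Tsum sum_symmetric_subshapes // -rE -dE.
have cP : #|P| = r1.
  by rewrite PE /core eD setIid card_subshapes // rE.
move: sgE agE; rewrite Ts cP fullE em eqxx => -> ->; split=> [-> | odd_r].
  by rewrite mul1r subrr addr0 subr0.
rewrite (negPf odd_r) mul0r add0r.
have [q rq] : exists q, r1 = q.*2 by exists r1./2; rewrite even_halfK.
pose e := ((n - d) %/ 2)%N.
have sgnE (R : pzRingType) : (-1 : R) ^+ e = if odd e then -1 else 1.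
  by rewrite -signr_odd; case: (odd e).
have q2 (F : numFieldType) : (2 * q)%:R / 2 = q%:R :> F.
  by rewrite natrM mulrAC mulfV ?pnatr_eq0 // mul1r.
have fl1 : Num.floor (((2 * q)%:R - 1) / 2 : rat) = q%:Z - 1.
  apply: floor_def; rewrite mulrBl q2 subrK rmorphB /= -[q%:~R]/(q%:R).
  by apply/andP; split; lra.
have fl2 : Num.floor (((2 * q)%:R + 1) / 2 : rat) = q%:Z.
  apply: floor_def; rewrite mulrDl q2 rmorphD /= -[q%:~R]/(q%:R).
  by apply/andP; split; lra.
rewrite rq -mul2n /eps -/e !sgnE; case: (odd e) => /=; rewrite ?opprK fl1 fl2.
  rewrite subrK q2 -addrA -opprD mulrBl q2 mulfV //; split=> //.
  by rewrite rmorphB.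
rewrite subrK q2 -addrA -opprD mulrBl q2 mulfV //; split=> //.
by rewrite rmorphB.
Qed.
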